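(* Let $a$ be a strongly regular scale factor (extended evenly to negative arguments), and suppose that either (i) $\dot a(0^+)=0$ and there is $\epsilon>0$ with $\ddot a(t)\ge0$ on $(0,\epsilon)$, or (ii) $\infty>\dot a(0^+)>0$. Then the partial derivative $\partial_\rho g_{\tau\tau}$ (which exists at every point of $D$) is continuous on $D$.
   Context: A function $a:[0,\infty)\to[0,\infty)$ is a regular scale factor if: (a) $a(0)=0$; (b) $a$ is increasing and continuous on $[0,\infty)$, twice continuously differentiable on $(0,\infty)$, with an inverse function on $[0,\infty)$; (c) $\frac{a(t)\ddot a(t)}{\dot a(t)^2}\le1$ for all $t>0$ (presupposing $\dot a(t)\ne0$). It is strongly regular if also $\frac{a\ddot a}{\dot a^2}\ge-K$ on $(0,\infty)$ for a constant $K\ge1$. $\dot a(0^+)=\lim_{t\to0^+}\dot a(t)$. Extend $a$ by $a(-t)=a(t)$. For $\tau>0$, $\rho_{\mathcal M_\tau}=\int_0^\tau\frac{a(t)}{\sqrt{a^2(\tau)-a^2(t)}}dt$ and $D=\{(\tau,\rho):\tau>0,\ 0<\rho<2\rho_{\mathcal M_\tau}\}$. For $(\tau,\rho)\in D$, $t_0(\tau,\rho)$ is the unique $t_0\in(-\tau,\tau)$ with $\rho=\int_{t_0}^\tau\frac{a(t)}{\sqrt{a^2(\tau)-a^2(t)}}dt$. For $0\le t_0<\tau$, $f(\tau,t_0)=\int_{t_0}^{\tau}\frac{\ddot a(t)}{\dot a(t)^2}\left(\frac{\sqrt{a^2(\tau)-a^2(t_0)}}{\sqrt{a^2(\tau)-a^2(t)}}-1\right)dt$;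 for $-\tau<t_0<0$, $f(\tau,t_0)=2f(\tau,0)-f(\tau,-t_0)$. Finally $g_{\tau\tau}(\tau,\rho)=-[1-\dot a(\tau)f(\tau,t_0(\tau,\rho))]^2$ on $D$. *)

(* Defs.v *)
From HB Require Import structures.
From mathcomp Require Import all_boot all_order all_algebra.
From mathcomp Require Import all_classical all_reals all_analysis.
Set Implicit Arguments. Unset Strict Implicit. Unset Printing Implicit Defensive.
Import Order.TTheory GRing.Theory Num.Theory.
Import numFieldNormedType.Exports.
Local Open Scope classical_set_scope.
Local Open Scope ring_scope.

Section Cosmo.
Variable R : realType.
Implicit Types (a : R -> R) (tau rho t : R).

Definition aev a t : R := a `|t|.

Definition adot a : R -> R := derive1 a.
Definition addot a : R -> R := derive1 (derive1 a).

Definition regular_scale_factor a : Prop :=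
  [/\ a 0 = 0,
      (forall s t, 0 <= s -> s < t -> a s < a t),
      {within `[0, +oo[, continuous a} &
      (forall y, 0 <= y -> exists t, 0 <= t /\ a t = y)] /\
  [/\ (forall t, 0 < t -> derivable a t 1 /\ derivable (adot a) t 1),
      {in `]0, +oo[, continuous (addot a)} &
      (forall t, 0 < t -> adot a t != 0 /\
                          a t * addot a t / (adot a t) ^+ 2 <= 1)].

Definition strongly_regular_scale_factor a : Prop :=
  regular_scale_factor a /\
  exists2 K : R, 1 <= K &
    forall t, 0 < t -> - K <= a t * addot a t / (adot a t) ^+ 2.

Definition rho_int a tau t0 : \bar R :=
  (\int[lebesgue_measure]_(t in `[t0, tau])
      (aev a t / Num.sqrt (a tau ^+ 2 - aev a t ^+ 2))%:E)%E.

Definition rhoM a tau : \bar R := rho_int a tau 0.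

Definition Ddom a : set (R * R) :=
  [set p | 0 < p.1 /\ 0 < p.2 /\ (p.2%:E < 2%:E * rhoM a p.1)%E].

Definition t0f a tau rho : R :=
  xget 0 [set t | - tau < t < tau /\ rho%:E = rho_int a tau t].

Definition f_pos a tau t0 : R :=
  fine (\int[lebesgue_measure]_(t in `[t0, tau])
     (addot a t / (adot a t) ^+ 2 *
       (Num.sqrt (a tau ^+ 2 - a t0 ^+ 2) / Num.sqrt (a tau ^+ 2 - a t ^+ 2)
        - 1))%:E)%E.

Definition ff a tau t0 : R :=
  if 0 <= t0 then f_pos a tau t0 else 2 * f_pos a tau 0 - f_pos a tau (- t0).

Definition gtt a tau rho : R :=
  - (1 - adot a tau * ff a tau (t0f a tau rho)) ^+ 2.

End Cosmo.

(* Main.v *)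
(* On [t0 > 0] both [rho] and [f] are differentiable in [t0] and
   [d f / d rho = Q], where
     [Q = adot(t0) * f / S + (1 - adot(t0) / adot(tau)) / S],
     [S = sqrt (a(tau)^2 - a(t0)^2)].
   The second derivative of [a], which may be badly behaved at [0], only enters
   through [f], and [f] extends continuously to [t0 = 0]; hence so does [Q], as
   soon as [adot] has a finite limit at [0+].  By the evenness of [a], the same
   formula holds for [t0 < 0] with [|t0|] in place of [t0].  Although
   [d rho / d t0] vanishes at [t0 = 0], Cauchy's mean value theorem bounds
   increments of [f] by increments of [rho], so [f] is differentiable in [rho]
   there as well, with the continuous derivative [Q].  Integrability at [t = tau]
   and uniformity in [tau] come from an explicit majorant of [a / S]. *)
Require Import Defs.
From HB Require Import structures.
From mathcomp Require Import all_boot all_order all_algebra.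
From mathcomp Require Import all_classical all_reals all_analysis.
From mathcomp Require Import measurable_realfun zify ring lra.
Set Implicit Arguments. Unset Strict Implicit. Unset Printing Implicit Defensive.
Import Order.TTheory GRing.Theory Num.Theory.
Import numFieldNormedType.Exports.
Local Open Scope classical_set_scope.
Local Open Scope ring_scope.

(** Differentiating [f] under its integral sign meets two obstacles. The integrand is singular at
    [t = tau], and [addot / adot ^ 2] is only known to be [O(1 / a)] near [0], which need not be
    integrable. The second obstacle is removed by the bracket in [f]: it is a multiple of
    [S tau t0 - S tau t], of order [a(t) ^ 2], so a factor [a] survives. The integrand depends on
    [t0] only through the factor [S tau t0]; hence [f / S] is an integral whose integrand is free of
    [t0], plus an elementary term coming from the primitive [- 1 / adot]. On differentiation the two
    occurrences of [addot] cancel. The two bounds on [a * addot / adot ^ 2] do different work: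
    together they give the [O(1 / a)] estimate, while the upper bound alone makes [a / adot]
    monotone, which compares values of [adot] at different times. The derivative of [t0] in [rho] is
    never taken: [t0] is only shown continuous, by inverting a strictly monotone function, and the
    derivative of [f] in [rho] is found from its difference quotients. *)

(** * Integrals that may be singular at an endpoint *)

Section RealAnalysis.
Context {R : realType}.
Notation mu := (@lebesgue_measure R).
Implicit Types (f h F : R -> R) (x y u v : R).

(** The derivative of [F] is not assumed continuous or integrable, so the fundamental theorem is
    applied to [h] instead: [F] minus the integral of [h] has nonnegative derivative. *)
Lemma integral_segment_le h F u v : u < v ->
  {within `[u, v], continuous h} -> {within `[u, v], continuous F} ->
  {in `]u, v[, forall t, derivable F t 1} ->
  {in `]u, v[, forall t, h t <= derive1 F t} ->
  (\int[mu]_(t in `[u, v]) (h t)%:E <= (F v - F u)%:E)%E.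
Proof.
move=> uv ch cF dF hF.
have hint : mu.-integrable `[u, v] (EFin \o h).
  by apply: continuous_compact_integrable => //; exact: segment_compact.
pose G t := \int[mu]_(r in `[u, t]) h r.
have dG t : t \in `]u, v[ -> derivable G t 1 /\ derive1 G t = h t.
  move=> tuv; have /andP[ut tv] : u < t < v by rewrite in_itv in tuv.
  apply: (@continuous_FTC1_closed R h u t v tv) => //.
  exact: within_continuous_continuous ch tuv.
have cG : {within `[u, v], continuous G}.
  exact: parameterized_integral_continuous (ltW uv) hint.
have mono := @ger0_derive1_le_cc R (F \- G) u v.
have : (F \- G) u <= (F \- G) v.
  apply: mono; rewrite ?in_itv/= ?lexx ?ltW//.
  - by move=> t tuv; apply: derivableB; [exact: dF|exact: (dG t tuv).1].
  - move=> t tuv; rewrite derive1E deriveB; [|exact: dF|exact: (dG t tuv).1].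
    by rewrite -!derive1E (dG t tuv).2 subr_ge0 hF.
  - by move=> t; apply: continuousB; [exact: cF|exact: cG].
have Gu : G u = 0 by rewrite /G set_itv1 Rintegral_set1.
rewrite /= Gu subr0 => FG.
have -> : (\int[mu]_(t in `[u, v]) (h t)%:E)%E = (G v)%:E.
  by rewrite /G /Rintegral fineK//; exact: integrable_fin_num hint.
by rewrite lee_fin; lra.
Qed.

Lemma continuous_oo_cc h x y u v : x < u -> v < y ->
  {in `]x, y[, continuous h} -> {within `[u, v], continuous h}.
Proof.
move=> xu vy ch; apply: continuous_in_subspaceT => t.
rewrite inE/= in_itv/= => /andP[ut tv]; apply: ch.
by rewrite in_itv/= (lt_le_trans xu ut) (le_lt_trans tv vy).
Qed.

Lemma measurable_continuous_oo h x y :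
  {in `]x, y[, continuous h} -> measurable_fun `]x, y[ h.
Proof.
move=> ch; apply: open_continuous_measurable_fun; first exact: interval_open.
by move=> t; rewrite inE/=; exact: ch.
Qed.

Lemma measurable_oo_itv h x y (b0 b1 : bool) : {in `]x, y[, continuous h} ->
  measurable_fun [set` Interval (BSide b0 x) (BSide b1 y)] h.
Proof.
move=> /measurable_continuous_oo; case: b0; case: b1 => //.
- by move=> /measurable_fun_itv_obnd_cbndP.
- by move=> /measurable_fun_itv_obnd_cbndP /measurable_fun_itv_bndo_bndcP.
- by move=> /measurable_fun_itv_bndo_bndcP.
Qed.

(** Meant for primitives whose derivative blows up at an endpoint. Monotone convergence over compact
    segments exhausting []x, y[] gives the integral, and monotonicity of [F] absorbs the ends cut
    off. *)
Lemma integral_oo_le h F x y : x < y ->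
  {in `]x, y[, continuous h} -> {within `[x, y], continuous F} ->
  {in `]x, y[, forall t, derivable F t 1} ->
  {in `]x, y[, forall t, 0 <= h t <= derive1 F t} ->
  (\int[mu]_(t in `]x, y[) (h t)%:E <= (F y - F x)%:E)%E.
Proof.
move=> xy ch cF dF hF.
(* The shift by three keeps [2 * d n] strictly below [y - x], so each segment [E n] is
   nondegenerate. *)
pose d (n : nat) := (y - x) / n.+3%:R.
have d0 n : 0 < d n by rewrite divr_gt0// subr_gt0.
have d2 n : 2 * d n < y - x.
  rewrite /d mulrA ltr_pdivrMr// mulrC ltr_pM2l ?subr_gt0// ltr_nat//.
pose E n := `[x + d n, y - d n]%classic.
have EU : \bigcup_n E n = `]x, y[%classic.
  apply/seteqP; split => t/=.
    move=> [n _]; rewrite /E/= !in_itv/= => /andP[xt ty].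
    by have := d0 n; move: xt ty; lra.
  rewrite in_itv/= => /andP[xt ty].
  pose m := Num.min (t - x) (y - t).
  have m0 : 0 < m by rewrite lt_min !subr_gt0 xt ty.
  have [n nlt] : exists n : nat, (y - x) / m < n%:R.
    exists (Num.bound ((y - x) / m)).
    by apply: archi_boundP; rewrite divr_ge0 ?subr_ge0 ?ltW.
  exists n => //; rewrite /E/= in_itv/=.
  have dm : d n <= m.
    rewrite /d ler_pdivrMr// mulrC -ler_pdivrMr//.
    by apply: (le_trans (ltW nlt)); rewrite ler_nat; lia.
  by move: dm; rewrite le_min; lra.
rewrite -EU.
have hm : measurable_fun `]x, y[ (EFin \o h).
  by apply/measurable_EFinP; exact: measurable_continuous_oo.
have Esub n : E n `<=` `]x, y[ by rewrite -EU; exact: bigcup_sup.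
have cvgE : (\int[mu]_(t in E i) (h t)%:E @[i --> \oo] -->
    \int[mu]_(t in \bigcup_i E i) (h t)%:E)%E.
  apply: ge0_nondecreasing_set_cvg_integral.
  - apply/nondecreasing_seqP => n; rewrite subsetEset => t; rewrite /E/= !in_itv/=.
    have : d n.+1 <= d n.
      by rewrite /d ler_pM2l ?subr_gt0// lef_pV2 ?posrE ?ltr0n// ler_nat.
    by lra.
  - by move=> n; exact: measurable_itv.
  - by move=> n; apply: measurable_funS hm => //; exact: Esub.
  - by move=> n t /Esub/= /hF /andP[h0 _]; rewrite lee_fin.
have dF0 t : t \in `]x, y[ -> 0 <= derive1 F t.
  by move=> /hF /andP[/le_trans]; apply.
have Fmono := @ger0_derive1_le_cc R F x y dF dF0 cF.
apply: (cvge_to_le cvgE); near=> n.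
apply: (@le_trans _ _ (F (y - d n) - F (x + d n))%:E).
  have sub t : t \in `]x + d n, y - d n[ -> t \in `]x, y[.
    by rewrite !in_itv/=; have := d0 n; lra.
  apply: integral_segment_le.
  - by have := d2 n; lra.
  - by apply: (continuous_oo_cc _ _ ch); have := d0 n; lra.
  - apply: continuous_subspaceW cF => t; rewrite /= !in_itv/=.
    by have := d0 n; lra.
  - by move=> t /sub/dF.
  - by move=> t /sub/hF /andP[].
by rewrite lee_fin; apply: lerB; apply: Fmono; rewrite ?in_itv/=;
  have := d0 n; have := d2 n; lra.
Unshelve. all: end_near. Qed.

Lemma Rintegral_segmentD h x u y : x <= u -> u <= y ->
  mu.-integrable `[x, y] (EFin \o h) ->
  \int[mu]_(t in `[x, y]) h t =
  \int[mu]_(t in `[x, u]) h t + \int[mu]_(t in `[u, y]) h t.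
Proof.
move=> xu uy hint.
have hint' : mu.-integrable `]u, y] (EFin \o h).
  apply: integrableS hint => // t; rewrite /= !in_itv/= => /andP[ut ->].
  by rewrite (le_trans xu) ?ltW.
rewrite -(Rintegral_itv_obnd_cbnd hint') -(Rintegral_itvB hint) ?bnd_simp//.
by rewrite addrC subrK.
Qed.

(** Near [u] the function is a constant minus an integral with variable upper limit. Only
    integrability is asked up to [y], so a singularity there does no harm. *)
Lemma is_derive_integral_lower h x u y : x < u -> u < y ->
  mu.-integrable `[x, y] (EFin \o h) -> {for u, continuous h} ->
  is_derive u 1 (fun s => \int[mu]_(t in `[s, y]) h t) (- h u).
Proof.
move=> xu uy hint ch.
have [dG G'] := @continuous_FTC1_closed R h x u y uy hint xu ch.
set G := fun s => \int[mu]_(t in `[x, s]) h t in dG G'.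
have dG' : is_derive u 1 G (h u) by rewrite -G' derive1E; exact/derivableP.
have dcG : is_derive u 1 (cst (\int[mu]_(t in `[x, y]) h t) - G) (- h u).
  by apply: is_derive_eq; rewrite sub0r.
apply: near_eq_is_derive dcG; near=> s.
have xs : x <= s by near: s; exact: lt_le_nbhsr.
have sy : s <= y by near: s; exact: lt_le_nbhsl.
by rewrite /= !fctE (Rintegral_segmentD xs sy hint) addrAC subrr add0r.
Unshelve. all: end_near. Qed.

Lemma continuous_integral_lower h x y : x <= y ->
  mu.-integrable `[x, y] (EFin \o h) ->
  {within `[x, y], continuous (fun s => \int[mu]_(t in `[s, y]) h t)}.
Proof.
move=> xy hint.
have cG := parameterized_integral_continuous xy hint.
have : {within `[x, y], continuous (fun s =>
    \int[mu]_(t in `[x, y]) h t - parameterized_integral mu x s h)}.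
  by move=> s; apply: cvgB; [exact: cvg_cst|exact: cG].
apply: subspace_eq_continuous => s; rewrite inE/= in_itv/= => /andP[xs sy].
rewrite /from_subspace /parameterized_integral (Rintegral_segmentD xs sy hint).
by rewrite addrAC subrr add0r.
Qed.

End RealAnalysis.

(** * First consequences of strong regularity *)

Section ScaleFactor.
Context {R : realType} (a : R -> R).
Hypothesis Ha : strongly_regular_scale_factor a.
Implicit Types (s t tau x y : R).

Definition root_gap tau t : R := Num.sqrt (a tau ^+ 2 - aev a t ^+ 2).
(** For [t > 0] this is the derivative of [- 1 / adot a], hence its elementary integral away from
    [0]. *)
Definition rel_accel t : R := addot a t / adot a t ^+ 2.

Local Notation w := rel_accel.

Lemma scale_lt s t : 0 <= s -> s < t -> a s < a t.
Proof. by case: Ha => -[[_ + _ _] _] _; exact. Qed.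

Lemma scale0 : a 0 = 0.
Proof. by case: Ha => -[[]]. Qed.

Lemma scale_le s t : 0 <= s -> s <= t -> a s <= a t.
Proof.
move=> s0; rewrite le_eqVlt => /predU1P[->//|st].
exact/ltW/scale_lt.
Qed.

Lemma scale_ge0 t : 0 <= t -> 0 <= a t.
Proof. by move=> t0; rewrite -scale0; exact: scale_le. Qed.

Lemma scale_gt0 t : 0 < t -> 0 < a t.
Proof. by move=> t0; rewrite -{1}scale0; exact: scale_lt. Qed.

Lemma is_derive_scale t : 0 < t -> is_derive t 1 a (adot a t).
Proof.
move=> t0; case: Ha => -[_ [dd _ _]] _; have [da _] := dd _ t0.
by rewrite /adot derive1E; exact/derivableP.
Qed.

Lemma is_derive_adot t : 0 < t -> is_derive t 1 (adot a) (addot a t).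
Proof.
move=> t0; case: Ha => -[_ [dd _ _]] _; have [_ da] := dd _ t0.
by rewrite /addot derive1E; exact/derivableP.
Qed.

Lemma continuous_scale t : 0 < t -> {for t, continuous a}.
Proof.
move=> /is_derive_scale da; apply/differentiable_continuous/derivable1_diffP.
exact: ex_derive.
Qed.

Lemma continuous_adot t : 0 < t -> {for t, continuous (adot a)}.
Proof.
move=> /is_derive_adot da; apply/differentiable_continuous/derivable1_diffP.
exact: ex_derive.
Qed.

Lemma continuous_aev : continuous (aev a).
Proof.
case: Ha => -[[_ _ /continuous_within_itvcyP[ca a0] _] _] _ t.
have [t0|t0|->] := ltgtP t 0.
- apply: (@cvg_trans _ (a (- x) @[x --> t])).
    apply: near_eq_cvg; near=> x; rewrite /aev ltr0_norm//.
    by near: x; exact: lt_nbhsl.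
  rewrite /aev ltr0_norm//; apply: (@cvg_comp _ _ _ -%R a _ (nbhs (- t))).
    exact: opp_continuous.
  by apply: continuous_scale; rewrite oppr_gt0.
- apply: (@cvg_trans _ (a x @[x --> t])).
    apply: near_eq_cvg; near=> x; rewrite /aev gtr0_norm//.
    by near: x; exact: lt_nbhsr.
  by rewrite /aev gtr0_norm//; exact: continuous_scale.
- rewrite /continuous_at /aev normr0; apply/cvgrPdist_lt => e e0.
  move/cvgrPdist_lt : a0 => /(_ _ e0)[d /= d0 dP].
  exists d => //= x /=; rewrite sub0r normrN => xd.
  have [->|x0] := eqVneq x 0; first by rewrite normr0 subrr normr0.
  by apply: dP; rewrite /= ?sub0r ?normrN ?normr_id ?normr_gt0.
Unshelve. all: end_near. Qed.

Lemma adot_gt0 t : 0 < t -> 0 < adot a t.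
Proof.
move=> t0; rewrite lt0r; apply/andP; split.
  by case: Ha => -[_ [_ _ /(_ _ t0)[]]].
apply: (@incr_derive1_ge0_itvy _ _ true 0).
- by move=> x; rewrite inE/= in_itv/= andbT => /is_derive_scale [].
- by move=> x y; rewrite !in_itv/= !andbT => x0 y0; exact: scale_lt.
- by rewrite in_itv/= t0.
Qed.

Lemma continuous_rel_accel t : 0 < t -> {for t, continuous w}.
Proof.
move=> t0; have adt : adot a t != 0 by rewrite gt_eqF// adot_gt0.
apply: cvgM.
  case: Ha => -[_ [_ ca _]] _.
  by apply: ca; rewrite in_itv/= t0.
apply: cvgV; first by rewrite sqrf_eq0.
by rewrite expr2; apply: cvgM; exact: continuous_adot.
Qed.

(** Since [K >= 1], the constant of the lower bound also dominates the upper bound [1], and the two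
    merge into a bound on the absolute value. *)
Lemma rel_accel_bound : exists2 K, 0 < K &
  forall t, 0 < t -> `|w t| <= K / a t.
Proof.
case: Ha => -[_ [_ _ ub]] [K K1 lb]; exists K; first exact: lt_le_trans K1.
move=> t t0; rewrite ler_pdivlMr ?scale_gt0// -{1}(gtr0_norm (scale_gt0 t0)).
rewrite -normrM mulrC /rel_accel mulrA ler_norml lb//=.
by apply: le_trans K1; exact: (ub _ t0).2.
Qed.

(** The derivative of [a / adot] is [1 - a * addot / adot ^ 2], nonnegative by regularity. This
    controls [adot] without any sign condition on [addot]. *)
Lemma scale_div_adot_le s t : 0 < s -> s <= t ->
  a s / adot a s <= a t / adot a t.
Proof.
move=> s0 st; pose q := a * (fun x => (adot a x)^-1) : R -> R.
have dq x : 0 < x -> is_derive x 1 q (1 - a x * w x).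
  move=> x0; have dx := adot_gt0 x0; rewrite /q.
  have d1 := is_derive_scale x0; have d2 := is_derive_adot x0.
  apply: is_derive_eq; first by apply: is_deriveM; apply: is_deriveV; rewrite gt_eqF.
  rewrite /GRing.scale/= /rel_accel; field.
  by rewrite gt_eqF.
have pos x : x \in `]s / 2, t + 1[ -> 0 < x.
  by rewrite in_itv/=; lra.
suff : q s <= q t by [].
apply: (@ger0_derive1_le_oo _ _ (s / 2) (t + 1)); rewrite ?in_itv/=; try lra.
- by move=> x /pos/dq [].
- move=> x /pos x0; rewrite derive1E (@derive_val _ _ _ _ _ _ _ (dq x x0)).
  by rewrite subr_ge0 /rel_accel mulrA; case: Ha => -[_ [_ _ /(_ _ x0)[]]].
- move=> x; rewrite inE => /pos/dq qx.
  by apply/differentiable_continuous/derivable1_diffP; exact: ex_derive.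
Qed.

End ScaleFactor.

(** * The integrand [aev a / S] and its majorant near [t = tau] *)

Section RootGap.
Context {R : realType} (a : R -> R).
Hypothesis Ha : strongly_regular_scale_factor a.
Notation mu := (@lebesgue_measure R).
Implicit Types (s t tau x y : R).
Local Notation S := (root_gap a).

Lemma aevE t : 0 <= t -> aev a t = a t.
Proof. by move=> t0; rewrite /aev ger0_norm. Qed.

Lemma aev_ge0 t : 0 <= aev a t.
Proof. exact: (scale_ge0 Ha). Qed.

Lemma root_gap_norm tau t : S tau `|t| = S tau t.
Proof. by rewrite /root_gap /aev normr_id. Qed.

Lemma sqr_gap_gt0 tau t : `|t| < tau -> 0 < a tau ^+ 2 - aev a t ^+ 2.
Proof.
move=> tt; rewrite subr_gt0 ltrXn2r//; first exact: aev_ge0.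
by apply: (scale_lt Ha).
Qed.

Lemma root_gap_gt0 tau t : `|t| < tau -> 0 < S tau t.
Proof. by move=> tt; rewrite sqrtr_gt0 sqr_gap_gt0. Qed.

Lemma root_gap_sqr tau t : `|t| < tau -> S tau t ^+ 2 = a tau ^+ 2 - aev a t ^+ 2.
Proof. by move=> tt; rewrite sqr_sqrtr// ltW// sqr_gap_gt0. Qed.

Lemma root_gap_anti tau s t : 0 <= s -> s <= t -> S tau t <= S tau s.
Proof.
move=> s0 st; rewrite ler_wsqrtr// lerB// !aevE ?(le_trans s0)//.
by rewrite lerXn2r ?nnegrE ?(scale_ge0 Ha) ?(scale_le Ha) ?(le_trans s0).
Qed.

Lemma root_gap_mono tau tau' t : 0 <= tau -> tau <= tau' -> S tau t <= S tau' t.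
Proof.
move=> s0 st; rewrite ler_wsqrtr// lerB//.
by rewrite lerXn2r ?nnegrE ?(scale_ge0 Ha) ?(scale_le Ha) ?(le_trans s0).
Qed.

Lemma root_gap_cvg {T : Type} (F : set_system T) {FF : Filter F} (f g : T -> R) tau t :
  0 < tau -> f @ F --> tau -> g @ F --> t ->
  S (f z) (g z) @[z --> F] --> S tau t.
Proof.
move=> t0 fF gF.
apply: (cvg_comp _ Num.sqrt); last exact: sqrt_continuous.
apply: cvgB; rewrite expr2.
- have af : a (f z) @[z --> F] --> a tau.
    by apply: (cvg_comp _ a fF); exact: (continuous_scale Ha).
  by under eq_fun do rewrite expr2; exact: cvgM.
- have ag : aev a (g z) @[z --> F] --> aev a t.
    by apply: (cvg_comp _ (aev a) gF); exact: (continuous_aev Ha).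
  by under eq_fun do rewrite expr2; exact: cvgM.
Qed.

Lemma continuous_root_gap tau : 0 < tau -> continuous (S tau).
Proof. by move=> t0 t; apply: (@root_gap_cvg _ _ _ (cst tau) id) => //; exact: cvg_cst. Qed.

Lemma is_derive_aev t : 0 < t -> is_derive t 1 (aev a) (adot a t).
Proof.
move=> t0; apply: near_eq_is_derive (is_derive_scale Ha t0); near=> x.
by rewrite aevE//; near: x; exact: lt_le_nbhsr.
Unshelve. all: end_near. Qed.

Lemma is_derive_root_gap tau t : 0 < t -> t < tau ->
  is_derive t 1 (S tau) (- (a t * adot a t) / S tau t).
Proof.
move=> t0 tt; have da := is_derive_aev t0.
have nt : `|t| < tau by rewrite gtr0_norm.
have S0 := root_gap_gt0 nt.
have dg : is_derive t 1 (fun x => a tau ^+ 2 - aev a x ^+ 2) (- (2 * a t * adot a t)).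
  have -> : (fun x => a tau ^+ 2 - aev a x ^+ 2) =
    cst (a tau ^+ 2) - aev a ^+ 2 by [].
  apply: is_derive_eq.
  by rewrite sub0r /GRing.scale/= expr1 aevE ?ltW.
have ds := is_derive1_sqrt (sqr_gap_gt0 nt).
have dc := @is_derive1_comp _ Num.sqrt (fun x => a tau ^+ 2 - aev a x ^+ 2) t _ _ ds dg.
apply: (is_derive_eq dc).
rewrite -/(root_gap a tau t); field.
by rewrite gt_eqF.
Qed.

Lemma continuous_scale_div_root_gap tau s t : 0 <= s -> t \in `]s, tau[ ->
  {for t, continuous (fun t => aev a t / S tau t)}.
Proof.
move=> s0; rewrite in_itv/= => /andP[st tt].
have t0 : 0 < t by exact: le_lt_trans st.
apply: cvgM; first exact: (continuous_aev Ha).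
apply: cvgV; last by apply: continuous_root_gap; exact: lt_trans tt.
by rewrite gt_eqF// root_gap_gt0// gtr0_norm.
Qed.

(** The integral from [s] to [tau] of an explicit majorant of [aev a / S]. It tends to [0] as [s]
    approaches [tau], which makes tails of integrals small. *)
Definition tail_bound tau s : R :=
  2 * (Num.sqrt (a tau) / adot a tau) * Num.sqrt (a tau - aev a s).
Local Notation B := tail_bound.

(* [a / adot] is nondecreasing and [S tau t ^ 2 >= a tau (a tau - a t)], so that
   [a / S <= sqrt (a tau) / adot tau * adot / sqrt (a tau - a)], which has an
   explicit primitive. *)
Lemma integral_scale_div_root_gap_le tau s : 0 <= s -> s < tau ->
  (\int[mu]_(t in `]s, tau[) (aev a t / S tau t)%:E <= (B tau s)%:E)%E.
Proof.
move=> s0 st; have tau0 : 0 < tau by exact: le_lt_trans st.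
have at0 := scale_gt0 Ha tau0; have dt0 := adot_gt0 Ha tau0.
pose F := - B tau.
have -> : B tau s = F tau - F s.
  by rewrite /F /= !opprfctE /B (aevE (ltW tau0)) subrr sqrtr0 mulr0 oppr0 add0r opprK.
have dF t : t \in `]s, tau[ ->
    is_derive t 1 F (Num.sqrt (a tau) / adot a tau * (adot a t / Num.sqrt (a tau - a t))).
  rewrite in_itv/= => /andP[stt tt]; have t0 : 0 < t by exact: le_lt_trans stt.
  have da := is_derive_aev t0.
  have gap : 0 < a tau - aev a t by rewrite aevE ?(ltW t0)// subr_gt0 (scale_lt Ha)// ltW.
  have ds := is_derive1_sqrt gap.
  have dg : is_derive t 1 (fun x => a tau - aev a x) (- adot a t).
    have -> : (fun x => a tau - aev a x) = cst (a tau) - aev a by [].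
    by apply: is_derive_eq; rewrite sub0r.
  have dc := @is_derive1_comp _ Num.sqrt (fun x => a tau - aev a x) t _ _ ds dg.
  have -> : F = - ((2 * (Num.sqrt (a tau) / adot a tau)) *:
     (Num.sqrt \o (fun x => a tau - aev a x))) by [].
  apply: is_derive_eq.
  rewrite /GRing.scale/= (aevE (ltW t0)).
  have : 0 < Num.sqrt (a tau - a t) by rewrite sqrtr_gt0 -(aevE (ltW t0)).
  move=> g0; field; by rewrite !gt_eqF.
apply: (@integral_oo_le _ _ F _ _ st).
- by move=> t /continuous_scale_div_root_gap; exact.
- apply: continuous_subspaceT => t; apply: cvgN; apply: cvgM; first exact: cvg_cst.
  apply: (cvg_comp _ Num.sqrt); last exact: sqrt_continuous.
  by apply: cvgB; [exact: cvg_cst|exact: (continuous_aev Ha)].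
- by move=> t /dF[].
- move=> t /[dup] tst /dF dFt.
  rewrite derive1E (@derive_val _ _ _ _ _ _ _ dFt).
  move: tst; rewrite in_itv/= => /andP[stt tt].
  have t0 : 0 < t by exact: le_lt_trans stt.
  have nt : `|t| < tau by rewrite gtr0_norm.
  have Sg := root_gap_gt0 nt.
  rewrite divr_ge0 ?aev_ge0 ?(ltW Sg)//= (aevE (ltW t0)).
  have gap : 0 < a tau - a t by rewrite subr_gt0 (scale_lt Ha)// ltW.
  have sg : 0 < Num.sqrt (a tau - a t) by rewrite sqrtr_gt0.
  have sa : 0 < Num.sqrt (a tau) by rewrite sqrtr_gt0.
  have adt := adot_gt0 Ha t0.
  have SS : Num.sqrt (a tau) * Num.sqrt (a tau - a t) <= S tau t.
    rewrite -sqrtrM ?(ltW at0)// /root_gap ler_wsqrtr// (aevE (ltW t0)).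
    have : a t <= a tau by rewrite (scale_le Ha) ?ltW.
    by have := scale_gt0 Ha t0; nra.
  have ratio : a t / adot a t <= a tau / adot a tau.
    by apply: (scale_div_adot_le Ha) => //; exact: ltW.
  rewrite ler_pdivrMr//.
  have ratio' : a t <= a tau / adot a tau * adot a t by rewrite -ler_pdivrMr.
  apply: (le_trans ratio').
  rewrite -{1}(sqr_sqrtr (ltW at0)).
  have -> : Num.sqrt (a tau) / adot a tau * (adot a t / Num.sqrt (a tau - a t)) * S tau t
    = (Num.sqrt (a tau) / adot a tau * adot a t) * (S tau t / Num.sqrt (a tau - a t)).
    by field; rewrite !gt_eqF.
  have -> : Num.sqrt (a tau) ^+ 2 / adot a tau * adot a t =
    (Num.sqrt (a tau) / adot a tau * adot a t) * Num.sqrt (a tau).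
    by field; rewrite gt_eqF.
  by rewrite ler_pM2l ?mulr_gt0 ?invr_gt0// ler_pdivlMr.
Qed.

(** Bounding the integral of the absolute value of [h] by [C * B tau s] yields both claims.
    Hypotheses are placed on the open interval because the integrands to come are not controlled at
    [tau], nor at [s] when [s = 0]. *)
Lemma dominated_integrable tau s C (h : R -> R) : 0 <= s -> s < tau ->
  {in `]s, tau[, continuous h} ->
  {in `]s, tau[, forall t, `|h t| <= C * (aev a t / S tau t)} ->
  mu.-integrable `[s, tau] (EFin \o h) /\
  `|\int[mu]_(t in `[s, tau]) h t| <= C * B tau s.
Proof.
move=> s0 st ch hC; have tau0 : 0 < tau by exact: le_lt_trans st.
have mh : measurable_fun `[s, tau] h by exact: measurable_oo_itv.
have mp : measurable_fun `]s, tau[ (fun t => aev a t / S tau t).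
  by apply: measurable_oo_itv => t /continuous_scale_div_root_gap; exact.
have Spos t : t \in `]s, tau[ -> 0 < aev a t / S tau t.
  rewrite in_itv/= => /andP[stt tt]; have t0 : 0 < t by exact: le_lt_trans stt.
  by rewrite divr_gt0 ?root_gap_gt0 ?gtr0_norm// aevE ?(scale_gt0 Ha)// ltW.
(* The sign of [C] is read off at the midpoint, where the majorant is positive. *)
have C0 : 0 <= C.
  have mid : (s + tau) / 2 \in `]s, tau[ by rewrite in_itv/=; lra.
  by rewrite -(pmulr_lge0 _ (Spos _ mid)); exact: le_trans (normr_ge0 _) (hC _ mid).
have le : (\int[mu]_(t in `[s, tau]) `|(h t)%:E| <= (C * B tau s)%:E)%E.
  rewrite integral_itv_bndoo; last first.
    apply/measurable_EFinP/measurableT_comp => //.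
    exact: (@measurable_oo_itv _ _ _ _ false true).
  apply: (@le_trans _ _ (\int[mu]_(t in `]s, tau[) (C%:E * (aev a t / S tau t)%:E))%E).
    apply: ge0_le_integral => //.
    - apply/measurable_EFinP/measurableT_comp => //.
      exact: (@measurable_oo_itv _ _ _ _ false true).
    - by apply/measurable_EFinP; apply: measurable_funM.
  rewrite ge0_integralZl ?lee_fin//; last 2 first.
  - exact/measurable_EFinP.
  - by move=> t tst; rewrite lee_fin ltW// Spos.
  by rewrite EFinM lee_wpmul2l ?lee_fin// integral_scale_div_root_gap_le.
have hint : mu.-integrable `[s, tau] (EFin \o h).
  apply/integrableP; split; first exact/measurable_EFinP.
  exact: le_lt_trans le (ltry _).
split => //; rewrite -lee_fin EFin_normr_Rintegral//.
by apply: le_trans le; apply: le_abse_integral => //; exact/measurable_EFinP.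
Qed.

End RootGap.

(** * Continuity of a singular integral in its upper endpoint *)

Section EndpointContinuity.
Context {R : realType} (a : R -> R).
Hypothesis Ha : strongly_regular_scale_factor a.
Notation mu := (@lebesgue_measure R).
Implicit Types (s t tau x y : R).
Local Notation S := (root_gap a).
Local Notation B := (tail_bound a).

Lemma tail_bound_cvg {T : Type} (F : set_system T) {FF : Filter F} (f g : T -> R) tau t :
  0 < tau -> f @ F --> tau -> g @ F --> t ->
  B (f z) (g z) @[z --> F] --> B tau t.
Proof.
move=> t0 fF gF.
have af : a (f z) @[z --> F] --> a tau.
  by apply: (cvg_comp _ a fF); exact: (continuous_scale Ha).
have ag : aev a (g z) @[z --> F] --> aev a t.
  by apply: (cvg_comp _ (aev a) gF); exact: (continuous_aev Ha).
have df : adot a (f z) @[z --> F] --> adot a tau.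
  by apply: (cvg_comp _ (adot a) fF); exact: (continuous_adot Ha).
apply: cvgM.
  apply: cvgM; first exact: cvg_cst.
  apply: cvgM; last by apply: cvgV => //; rewrite gt_eqF// (adot_gt0 Ha).
  by apply: (cvg_comp _ Num.sqrt af); exact: sqrt_continuous.
apply: (cvg_comp _ Num.sqrt); last exact: sqrt_continuous.
exact: cvgB.
Qed.

Lemma tail_bound_self tau : 0 <= tau -> B tau tau = 0.
Proof. by move=> t0; rewrite /tail_bound aevE// subrr sqrtr0 mulr0. Qed.

(* The singularity at [t = x] moves with the parameter, so no single majorant works
   on all of [[s, x]]: split at a fixed [c < tau], where the part beyond [c] is
   uniformly small. *)
Lemma dominated_endpoint_continuous (h : R -> R -> R) s tau u v C :
  0 <= s -> s <= u -> u < tau < v -> 0 < C ->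
  (forall x, u < x < v -> {in `]s, x[, continuous (h x)}) ->
  (forall x t, u < x < v -> s < t < x -> `|h x t| <= C * (aev a t / S x t)) ->
  (forall x t, u < x < v -> s < t < x -> {for x, continuous (h^~ t)}) ->
  {for tau, continuous (fun x => \int[mu]_(t in `[s, x]) h x t)}.
Proof.
move=> s0 su /andP[ut tv] C0 ch hC ct.
have tau0 : 0 < tau by apply: le_lt_trans ut; exact: le_trans su.
apply/cvgrPdist_lt => e e0.
(* The two tails beyond [c], for [tau] and for [x], each cost less than [e / 4]; the part before [c]
   may cost [e / 2]. *)
have e40 : 0 < e / (4 * C) by rewrite divr_gt0// mulr_gt0.
have Bself : B tau x @[x --> tau^'-] --> (0 : R).
  rewrite -(tail_bound_self (ltW tau0)).
  apply: (@tail_bound_cvg _ _ _ (cst tau) id) => //; first exact: cvg_cst.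
  exact: cvg_at_left_filter cvg_id.
have [c [uc ct' Bc]] : exists c, [/\ u < c, c < tau & B tau c < e / (4 * C)].
  near (tau^'-) => c; exists c; split; near: c.
  - exact: nbhs_left_gt.
  - exact: nbhs_left_lt.
  - exact: cvgr_lt Bself _ e40.
have sc : s < c by exact: le_lt_trans uc.
have c0 : 0 <= c by exact: le_trans (ltW sc).
(* For [x > c'] and [t <= c] one has [S x t >= S c' c > 0]; this margin turns the domination into a
   constant majorant on []s, c]]. *)
pose c' := (c + tau) / 2.
have [cc' c't] : c < c' /\ c' < tau by rewrite /c'; split; lra.
have Bnear : \forall x \near tau, B x c < e / (4 * C).
  have : B x c @[x --> tau] --> B tau c.
    by apply: (@tail_bound_cvg _ _ _ id (cst c)) => //; exact: cvg_cst.
  by move/cvgr_lt; exact.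
have xint x : u < x < v -> c < x -> mu.-integrable `[s, x] (EFin \o h x).
  move=> uxv cx; have /andP[ux xv] := uxv.
  apply: (dominated_integrable (C := C) Ha s0 _ (ch x uxv) _).1.
    exact: lt_trans cx.
  by move=> t; rewrite in_itv/= => /(hC _ _ uxv).
have split x : u < x < v -> c < x ->
    \int[mu]_(t in `[s, x]) h x t =
    \int[mu]_(t in `[s, c]) h x t + \int[mu]_(t in `[c, x]) h x t.
  by move=> uxv cx; apply: Rintegral_segmentD; rewrite ?ltW//; exact: xint.
have tail x : u < x < v -> c < x ->
    `|\int[mu]_(t in `[c, x]) h x t| <= C * B x c.
  move=> uxv cx; apply: (dominated_integrable Ha c0 cx _ _).2.
    move=> t; rewrite in_itv/= => /andP[ct1 tx]; apply: (ch x uxv).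
    by rewrite in_itv/= tx (lt_trans sc).
  move=> t; rewrite in_itv/= => /andP[ct1 tx]; apply: (hC x t uxv).
  by rewrite tx (lt_trans sc).
have scint x : u < x < v -> c < x -> mu.-integrable `]s, c] (EFin \o h x).
  move=> uxv cx; apply: integrableS (xint _ uxv cx) => //.
  move=> t; rewrite /= !in_itv/= => /andP[st tc].
  by rewrite (ltW st)/= (le_trans tc)// ltW.
have head : {for tau, continuous (fun x => \int[mu]_(t in `[s, c]) h x t)}.
  have I x : `]c', v[%classic x -> u < x < v /\ c < x.
    by rewrite /= in_itv/=; lra.
  have cont : {in `]c', v[%classic, continuous (fun x => \int[mu]_(t in `]s, c]) h x t)}.
    apply: (@continuity_under_integral _ _ _ mu h `]s, c] _ _ _ _ _
      (cst (C * (a c / S c' c)))) => //.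
    - by move=> x /I[uxv cx]; exact: scint.
    - apply: aeW => t; rewrite /= in_itv/= => /andP[st tc] x.
      rewrite inE => /I[uxv cx]; apply: ct => //.
      by rewrite st (le_lt_trans tc).
    - have : mu.-integrable `[s, c] (EFin \o cst (C * (a c / S c' c))).
        apply: continuous_compact_integrable; first exact: segment_compact.
        by apply: continuous_subspaceT => t; exact: cvg_cst.
      apply: integrableS => // t; rewrite /= !in_itv/= => /andP[st ->].
      by rewrite ltW.
    - move=> x /[dup] /I[uxv cx] c'xv; apply: aeW => t.
      rewrite /= in_itv/= => /andP[st tc].
      have tx : t < x by exact: le_lt_trans cx.
      apply: (le_trans (hC x t uxv _)); first by rewrite st.
      have t0 : 0 <= t by exact: le_trans (ltW st).
      have S1 : 0 < S c' c by rewrite root_gap_gt0// ger0_norm.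
      have S2 : S c' c <= S x t.
        apply: le_trans (root_gap_anti Ha x t0 tc).
        apply: (root_gap_mono Ha); first by rewrite (le_trans c0)// ltW.
        by move: c'xv; rewrite /= in_itv/=; lra.
      rewrite ler_pM2l//; apply: ler_pM; first exact: (aev_ge0 Ha).
      + by rewrite invr_ge0 (le_trans (ltW S1)).
      + by rewrite aevE// (scale_le Ha).
      + by rewrite lef_pV2 ?posrE ?(lt_le_trans S1 S2).
  have tauI : tau \in `]c', v[%classic by rewrite inE/= in_itv/= c't.
  have near_eq : \forall x \near tau, \int[mu]_(t in `]s, c]) h x t =
      \int[mu]_(t in `[s, c]) h x t.
    have := @near_in_itvoo _ c' v tau; rewrite in_itv/= c't tv => /(_ isT).
    apply: filterS => x; rewrite in_itv/= => xI.
    by apply: Rintegral_itv_obnd_cbnd; apply: scint; lra.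
  rewrite /prop_for /continuous_at -(nbhs_singleton near_eq).
  apply: cvg_trans (cont tau tauI).
  exact: near_eq_cvg near_eq.
have e2 : 0 < e / 2 by rewrite divr_gt0.
move/cvgrPdist_lt : head => /(_ _ e2) head.
have tauI : u < tau < v by rewrite ut tv.
near=> x.
have xI : u < x < v.
  have : x \in `]u, v[ by near: x; apply: near_in_itvoo; rewrite in_itv/= ut.
  by rewrite in_itv.
have cx : c < x by near: x; exact: lt_nbhsr.
rewrite (split tau)// (split x)// opprD addrACA.
apply: (le_lt_trans (ler_normD _ _)).
have h1 : `|\int[mu]_(t in `[s, c]) h tau t - \int[mu]_(t in `[s, c]) h x t| < e / 2.
  by near: x; exact: head.
have h2 : `|\int[mu]_(t in `[c, tau]) h tau t - \int[mu]_(t in `[c, x]) h x t| < e / 2.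
  apply: (le_lt_trans (ler_normB _ _)).
  have t1 := tail _ tauI ct'; have t2 := tail _ xI cx.
  have Bx : B x c < e / (4 * C) by near: x.
  have q y : y < e / (4 * C) -> C * y < e / 4.
    have -> : e / 4 = C * (e / (4 * C)) by field; rewrite gt_eqF.
    by rewrite ltr_pM2l.
  by have := q _ Bx; have := q _ Bc; lra.
by lra.
Unshelve. all: end_near. Qed.

End EndpointContinuity.

(** * The distance [rho] as a function of [tau] and of the lower endpoint *)

Section ProperDistance.
Context {R : realType} (a : R -> R).
Hypothesis Ha : strongly_regular_scale_factor a.
Notation mu := (@lebesgue_measure R).
Implicit Types (s t tau x y : R).
Local Notation S := (root_gap a).

Definition rho_fun tau s : R := \int[mu]_(t in `[s, tau]) (aev a t / S tau t).
Local Notation P := rho_fun.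

Lemma integrable_rho tau : 0 < tau ->
  mu.-integrable `[0, tau] (fun t => (aev a t / S tau t)%:E).
Proof.
move=> tau0; have := @dominated_integrable _ _ Ha tau 0 1
  (fun t => aev a t / S tau t) (lexx _) tau0.
case=> //.
- by move=> t; exact: (continuous_scale_div_root_gap Ha).
- move=> t; rewrite in_itv/= => /andP[t0 tt].
  by rewrite mul1r ger0_norm// divr_ge0 ?(aev_ge0 Ha)// sqrtr_ge0.
Qed.

Lemma integrable_rho_sub tau s x : 0 <= s -> x <= tau -> 0 < tau ->
  mu.-integrable `[s, x] (fun t => (aev a t / S tau t)%:E).
Proof.
move=> s0 xt tau0; apply: integrableS (integrable_rho tau0) => //.
by move=> t; rewrite /= !in_itv/= => /andP[st tx]; rewrite (le_trans s0)// (le_trans tx).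
Qed.

Lemma rho_intE tau s : 0 <= s -> s < tau -> rho_int a tau s = (P tau s)%:E.
Proof.
move=> s0 st; rewrite /P /rho_fun /Rintegral fineK//.
apply: integrable_fin_num => //; apply: integrable_rho_sub => //.
exact: le_lt_trans st.
Qed.

(** Evenness folds [[- s, 0]] onto [[0, s]], whose integral is [P tau 0 - P tau s]. The split at [0]
    uses nonnegativity, so it needs no prior finiteness on all of [[- s, tau]]. *)
Lemma rho_intN tau s : 0 <= s -> s < tau ->
  rho_int a tau (- s) = (2 * P tau 0 - P tau s)%:E.
Proof.
move=> s0 st; have tau0 : 0 < tau by exact: le_lt_trans st.
pose p t := aev a t / S tau t.
have cp : {within `[- s, s], continuous p}.
  apply: continuous_in_subspaceT => t; rewrite inE/= in_itv/= => /andP[st1 ts].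
  apply: cvgM; first exact: (continuous_aev Ha).
  apply: cvgV; last exact: (continuous_root_gap Ha).
  rewrite gt_eqF// (root_gap_gt0 Ha)//.
  by apply: le_lt_trans st; rewrite ler_norml st1.
have neg : (\int[mu]_(t in `[(- s)%R, 0%R]) (p t)%:E = \int[mu]_(t in `[0%R, s]) (p t)%:E)%E.
  have := @integration_by_substitution_oppr R p 0 s s0.
  rewrite oppr0 => ->; last first.
    apply: continuous_subspaceW cp => t; rewrite /= !in_itv/= => /andP[-> t0].
    by rewrite (le_trans t0).
  by apply: eq_integral => t _; rewrite /p /root_gap /aev /= normrN.
have int1 : mu.-integrable `[- s, s] (EFin \o p).
  by apply: continuous_compact_integrable cp; exact: segment_compact.
have int2 := integrable_rho tau0.
have int3 : mu.-integrable `[0, s] (EFin \o p) by apply: integrable_rho_sub => //; exact: ltW.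
have pos t : 0 <= p t by rewrite divr_ge0 ?(aev_ge0 Ha)// sqrtr_ge0.
have eqU : `[- s, tau]%classic = (`[- s, 0] `|` `]0, tau])%classic :> set R.
  rewrite -itv_bndbnd_setU//.
  - by rewrite bnd_simp oppr_le0.
  - by rewrite bnd_simp ltW.
have mp : measurable_fun `[- s, tau] (EFin \o p).
  rewrite eqU; apply/measurable_funU => //; split.
    apply: (measurable_int mu); apply: integrableS int1 => //.
    move=> t; rewrite /= !in_itv/= => /andP[-> t0]; exact: le_trans s0.
  apply: (measurable_int mu); apply: integrableS int2 => //.
  by move=> t; rewrite /= !in_itv/= => /andP[/ltW -> ->].
have splt : (rho_int a tau (- s) = \int[mu]_(t in `[(- s)%R, 0%R]) (p t)%:E +
    \int[mu]_(t in `[0%R, tau]) (p t)%:E)%E.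
  rewrite /rho_int eqU ge0_integral_setU//.
  - congr (_ + _)%E; apply: integral_itv_obnd_cbnd.
    apply: measurable_funS (measurable_int mu int2) => //.
    by move=> t; rewrite /= !in_itv/= => /andP[/ltW -> ->].
  - by rewrite -eqU.
  - by move=> t _; rewrite lee_fin; exact: pos.
  - apply/disj_setPS => t [] /=; rewrite !in_itv/= => /andP[_ t0] /andP[+ _].
    by rewrite ltNge t0.
rewrite splt neg.
have -> : (\int[mu]_(t in `[0%R, tau]) (p t)%:E)%E = (P tau 0)%:E.
  exact: (rho_intE (lexx 0) tau0).
have -> : (\int[mu]_(t in `[0%R, s]) (p t)%:E)%E = (\int[mu]_(t in `[0, s]) p t)%:E.
  by rewrite /Rintegral fineK//; exact: integrable_fin_num int3.
rewrite -EFinD; congr (_%:E).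
rewrite /P /rho_fun (@Rintegral_segmentD _ _ 0 s tau) ?(ltW st)// -/p; lra.
Qed.

Lemma is_derive_rho tau s : 0 < s -> s < tau ->
  is_derive s 1 (P tau) (- (a s / S tau s)).
Proof.
move=> s0 st; have tau0 : 0 < tau by exact: lt_trans st.
rewrite -(aevE _ (ltW s0)).
apply: (is_derive_integral_lower s0 st (integrable_rho tau0)).
by apply: (@continuous_scale_div_root_gap _ _ Ha tau 0) => //; rewrite in_itv/= s0.
Qed.

Lemma continuous_rho tau : 0 < tau -> {within `[0, tau], continuous (P tau)}.
Proof. by move=> t0; apply: continuous_integral_lower; [exact: ltW|exact: integrable_rho]. Qed.

Lemma rho_fun_lt tau s t : 0 <= s -> s < t -> t < tau -> P tau t < P tau s.
Proof.
move=> s0 st tt; rewrite -ltrN2.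
apply: (@gtr0_derive1_lt_cc _ (- P tau) s t).
- move=> x; rewrite in_itv/= => /andP[sx xt].
  by apply: derivableN; apply: (@ex_derive _ _ _ _ _ _ _ (is_derive_rho _ _));
    [exact: le_lt_trans sx|exact: lt_trans tt].
- move=> x; rewrite in_itv/= => /andP[sx xt].
  have x0 : 0 < x by exact: le_lt_trans sx.
  have xtau : x < tau by exact: lt_trans tt.
  have dP := is_derive_rho x0 xtau.
  rewrite derive1E deriveN ?(@derive_val _ _ _ _ _ _ _ dP) ?opprK.
    by rewrite divr_gt0 ?(scale_gt0 Ha)// (root_gap_gt0 Ha)// gtr0_norm.
  by case: dP.
- move=> x; apply: cvgN; move: x; apply: continuous_subspaceW (continuous_rho _).
    move=> x; rewrite /= !in_itv/= => /andP[sx xt].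
    by rewrite (le_trans s0)// (le_trans xt)// ltW.
  by apply: lt_trans tt; exact: le_lt_trans st.
- by rewrite in_itv/= lexx ltW.
- by rewrite in_itv/= lexx ltW.
- by [].
Qed.

Lemma continuous_rho_tau tau s : 0 <= s -> s < tau -> {for tau, continuous (P^~ s)}.
Proof.
move=> s0 st.
apply: (@dominated_endpoint_continuous _ _ Ha (fun x t => aev a t / S x t)
  s tau s (tau + 1) 1) => //.
- by rewrite st /= ltrDl ltr01.
- move=> x _ t; exact: (continuous_scale_div_root_gap Ha).
- move=> x t _ _.
  by rewrite mul1r ger0_norm// divr_ge0 ?(aev_ge0 Ha)// sqrtr_ge0.
- move=> x t _ /andP[st1 tx]; have t0 : 0 <= t by rewrite (le_trans s0)// ltW.
  apply: cvgM; first exact: cvg_cst.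
  apply: cvgV; first by rewrite gt_eqF// (root_gap_gt0 Ha)// ger0_norm.
  apply: (@root_gap_cvg _ _ Ha _ _ _ id (cst t)) => //; last exact: cvg_cst.
  exact: le_lt_trans tx.
Qed.

End ProperDistance.

(** * The function [f] and the quotient [f / S] for nonnegative lower endpoint *)

Section NormalizedF.
Context {R : realType} (a : R -> R).
Hypothesis Ha : strongly_regular_scale_factor a.
Notation mu := (@lebesgue_measure R).
Implicit Types (s t tau x y : R).
Local Notation S := (root_gap a).
Local Notation w := (rel_accel a).

(** The parameter [s] is separate from the lower limit of integration, so that the kernel for
    [s = 0] can also be integrated from a positive point. *)
Definition f_kernel tau s t : R := w t * (S tau s / S tau t - 1).

(* Dividing [f] by [S] makes its derivative in [s] free of [f] itself and of
   [1 / adot s], hence locally bounded down to [s = 0]. *)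
Definition f_norm tau s : R := f_pos a tau s / S tau s.

Lemma f_posE tau s : 0 <= s ->
  f_pos a tau s = \int[mu]_(t in `[s, tau]) f_kernel tau s t.
Proof.
move=> s0; rewrite /f_pos /Rintegral; congr fine; apply: eq_integral => t.
rewrite inE/= in_itv/= => /andP[st _].
by rewrite /f_kernel /root_gap !aevE// (le_trans s0).
Qed.

(** The difference [S tau s - S tau t] is at most [a t ^ 2 / S tau s]: one factor [a t] cancels the
    [1 / a t] of [w], the other forms [aev a t / S tau t]. The bound therefore survives at
    [s = 0]. *)
Lemma f_kernel_bound K tau s t : 0 <= K -> `|w t| <= K / a t -> 0 <= s -> s < t -> t < tau ->
  `|f_kernel tau s t| <= K / S tau s * (aev a t / S tau t).
Proof.
move=> K0 wK s0 st tt; have t0 : 0 < t by exact: le_lt_trans st.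
have ns : `|s| < tau by rewrite ger0_norm// (lt_trans st).
have nt : `|t| < tau by rewrite gtr0_norm.
have Ss := root_gap_gt0 Ha ns; have St := root_gap_gt0 Ha nt.
have at0 := scale_gt0 Ha t0.
have SS : S tau t <= S tau s by apply: (root_gap_anti Ha) => //; exact: ltW.
have sub : S tau s - S tau t <= a t ^+ 2 / S tau s.
  rewrite ler_pdivlMr//.
  have := root_gap_sqr Ha ns; have := root_gap_sqr Ha nt.
  rewrite !aevE ?(ltW t0)// => e1 e2.
  have : 0 <= a s ^+ 2 by exact: sqr_ge0.
  by nra.
rewrite /f_kernel normrM (aevE _ (ltW t0)).
have -> : S tau s / S tau t - 1 = (S tau s - S tau t) / S tau t.
  by field; rewrite gt_eqF.
rewrite [X in _ * X]ger0_norm; last by rewrite divr_ge0 ?subr_ge0// ltW.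
apply: (@le_trans _ _ (K / a t * (a t ^+ 2 / S tau s / S tau t))).
  apply: ler_pM => //; first by rewrite divr_ge0 ?subr_ge0// ltW.
  by rewrite ler_pM2r ?invr_gt0.
by rewrite le_eqVlt; apply/orP; left; apply/eqP; field; rewrite !gt_eqF.
Qed.

Lemma continuous_f_kernel tau s : 0 < tau -> 0 <= s ->
  {in `]s, tau[, continuous (f_kernel tau s)}.
Proof.
move=> tau0 s0 t; rewrite in_itv/= => /andP[st tt].
have t0 : 0 < t by exact: le_lt_trans st.
apply: cvgM; first exact: (continuous_rel_accel Ha).
apply: cvgB; last exact: cvg_cst.
apply: cvgM; first exact: cvg_cst.
apply: cvgV; last exact: (continuous_root_gap Ha).
by rewrite gt_eqF// (root_gap_gt0 Ha)// gtr0_norm.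
Qed.

Lemma integrable_f_kernel tau s : 0 <= s -> s < tau ->
  mu.-integrable `[s, tau] (EFin \o f_kernel tau s).
Proof.
move=> s0 st; have [K K0 wK] := rel_accel_bound Ha.
apply: (@dominated_integrable _ _ Ha tau s (K / S tau s) _ s0 st _ _).1.
- by apply: continuous_f_kernel => //; exact: le_lt_trans st.
- move=> t; rewrite in_itv/= => /andP[st1 tt]; apply: f_kernel_bound => //.
    exact: ltW.
  by apply: wK; exact: le_lt_trans st1.
Qed.

Lemma integrable_rel_accel tau s : 0 < s -> s < tau ->
  mu.-integrable `[s, tau] (EFin \o w).
Proof.
move=> s0 st; apply: continuous_compact_integrable; first exact: segment_compact.
apply: continuous_in_subspaceT => t; rewrite inE/= in_itv/= => /andP[st1 _].
by apply: (continuous_rel_accel Ha); exact: lt_le_trans st1.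
Qed.

Lemma integral_rel_accel tau s : 0 < s -> s < tau ->
  \int[mu]_(t in `[s, tau]) w t = (adot a s)^-1 - (adot a tau)^-1.
Proof.
move=> s0 st; pose F t := - (adot a t)^-1.
have dF t : 0 < t -> is_derive t 1 F (w t).
  move=> t0; have dt := adot_gt0 Ha t0; have da := is_derive_adot Ha t0.
  have dn : adot a t != 0 by rewrite gt_eqF.
  have dV := is_deriveV dn da.
  have -> : F = - (fun x => (adot a x)^-1) by [].
  apply: is_derive_eq.
  by rewrite /GRing.scale/= /rel_accel -mulNr opprK mulrC.
have cF t : 0 < t -> {for t, continuous F}.
  move=> /dF dFt; apply/differentiable_continuous/derivable1_diffP.
  by case: dFt.
rewrite /Rintegral (@continuous_FTC2 _ w F s tau st).
- by rewrite -EFinB/= /F opprK addrC.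
- apply: continuous_in_subspaceT => t; rewrite inE/= in_itv/= => /andP[st1 _].
  by apply: (continuous_rel_accel Ha); exact: lt_le_trans st1.
- split.
  + move=> t; rewrite in_itv/= => /andP[st1 _].
    by case: (dF t (lt_trans s0 st1)).
  + by apply: cvg_at_right_filter; exact: cF.
  + by apply: cvg_at_left_filter; apply: cF; exact: lt_trans st.
- move=> t; rewrite in_itv/= => /andP[st1 _].
  by rewrite derive1E (@derive_val _ _ _ _ _ _ _ (dF t (lt_trans s0 st1))).
Qed.

Lemma integrable_rel_accel_div tau s : 0 < s -> s < tau ->
  mu.-integrable `[s, tau] (EFin \o (fun t => w t / S tau t)).
Proof.
move=> s0 st; have [K K0 wK] := rel_accel_bound Ha.
have as0 := scale_gt0 Ha s0.
(* From [a s <= a t] one gets [K / a t <= K / a s ^ 2 * a t]; this constant degenerates as [s] tends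
   to [0]. *)
apply: (@dominated_integrable _ _ Ha tau s (K / a s ^+ 2) _ (ltW s0) st _ _).1.
- move=> t; rewrite in_itv/= => /andP[st1 tt].
  have t0 : 0 < t by exact: lt_trans st1.
  apply: cvgM; first exact: (continuous_rel_accel Ha).
  apply: cvgV; last by apply: (continuous_root_gap Ha); exact: lt_trans tt.
  by rewrite gt_eqF// (root_gap_gt0 Ha)// gtr0_norm.
- move=> t; rewrite in_itv/= => /andP[st1 tt].
  have t0 : 0 < t by exact: lt_trans st1.
  have nt : `|t| < tau by rewrite gtr0_norm.
  have St := root_gap_gt0 Ha nt; have at0 := scale_gt0 Ha t0.
  rewrite normrM [X in _ * X]ger0_norm ?invr_ge0 ?(ltW St)// (aevE _ (ltW t0)) mulrA.
  rewrite ler_pM2r ?invr_gt0//; apply: (le_trans (wK _ t0)).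
  have aa : a s <= a t by rewrite (scale_le Ha) ?(ltW s0) ?(ltW st1).
  rewrite -mulrA ler_pM2l// -(ler_pM2r at0) mulVf ?gt_eqF//.
  rewrite -mulrA -expr2 mulrC ler_pdivlMr ?exprn_gt0// mul1r.
  by rewrite lerXn2r// nnegrE ltW.
Qed.

(** Isolates the only dependence of the kernel on [s], the factor [S tau s]. The lower limit must be
    positive, since [w] alone may fail to be integrable at [0]. *)
Lemma f_kernel_split tau s x : 0 <= s -> 0 < x -> x < tau ->
  \int[mu]_(t in `[x, tau]) f_kernel tau s t =
  S tau s * \int[mu]_(t in `[x, tau]) (w t / S tau t) -
  ((adot a x)^-1 - (adot a tau)^-1).
Proof.
move=> s0 x0 xt; have i1 := integrable_rel_accel_div x0 xt.
rewrite -integral_rel_accel// -RintegralZl// -RintegralB//.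
- by apply: eq_Rintegral => t _; rewrite /f_kernel; ring.
- by apply: (integrableZl _ (S tau s) i1).
- exact: integrable_rel_accel.
Qed.

Lemma f_normE tau s : 0 < s -> s < tau ->
  f_norm tau s = \int[mu]_(t in `[s, tau]) (w t / S tau t) -
    ((adot a s)^-1 - (adot a tau)^-1) / S tau s.
Proof.
move=> s0 st; rewrite /f_norm f_posE ?(ltW s0)// f_kernel_split ?(ltW s0)//.
have := @root_gap_gt0 _ _ Ha tau s; rewrite gtr0_norm// => /(_ st) S0.
by field; rewrite !gt_eqF ?(adot_gt0 Ha)// (lt_trans s0).
Qed.

(** The integral contributes [- w s / S tau s], and the derivative of [1 / adot s] contributes the
    opposite term. What remains comes from differentiating [1 / S]. *)
Lemma is_derive_f_norm tau s : 0 < s -> s < tau ->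
  is_derive s 1 (f_norm tau) (- (a s / S tau s ^+ 3 * (1 - adot a s / adot a tau))).
Proof.
move=> s0 st; have tau0 : 0 < tau by exact: lt_trans st.
have ns : `|s| < tau by rewrite gtr0_norm.
have S0 := root_gap_gt0 Ha ns; have dt := adot_gt0 Ha tau0; have ds := adot_gt0 Ha s0.
(* Starting the integral at [s / 2] leaves room to the left of [s] while avoiding [0]. *)
have s20 : 0 < s / 2 by lra.
have s2s : s / 2 < s by lra.
have s2t : s / 2 < tau by lra.
have cont : {for s, continuous (fun t => w t / S tau t)}.
  apply: cvgM; first exact: (continuous_rel_accel Ha).
  by apply: cvgV; [rewrite gt_eqF|exact: (continuous_root_gap Ha)].
have dJ := is_derive_integral_lower s2s st (integrable_rel_accel_div s20 s2t) cont.
have Sn : S tau s != 0 by rewrite gt_eqF.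
have dSV := is_deriveV Sn (is_derive_root_gap Ha s0 st).
have dn : adot a s != 0 by rewrite gt_eqF.
have dadV := is_deriveV dn (is_derive_adot Ha s0).
set J := (fun _ => _) in dJ.
set SV := (fun _ => _) in dSV.
set adV := (fun _ => _) in dadV.
have dsum : is_derive s 1 (J - (adV - cst (adot a tau)^-1) * SV)
    (- (a s / S tau s ^+ 3 * (1 - adot a s / adot a tau))).
  apply: is_derive_eq; rewrite /GRing.scale/= !fctE /SV /adV /rel_accel.
  by field; rewrite Sn dn gt_eqF.
apply: near_eq_is_derive dsum; near=> x.
rewrite f_normE//; first by near: x; exact: lt_nbhsr.
by near: x; exact: lt_nbhsl.
Unshelve. all: end_near. Qed.

End NormalizedF.

(** * The quotient [f / S] down to [s = 0], and its joint continuity *)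

Section JointContinuity.
Context {R : realType} (a : R -> R).
Hypothesis Ha : strongly_regular_scale_factor a.
Notation mu := (@lebesgue_measure R).
Implicit Types (s t tau x y : R).
Local Notation S := (root_gap a).

(** In the formula for positive [s], separate terms may diverge as [s] tends to [0]. In the
    difference with the value at [0], the factor with [1 / adot s] is multiplied by
    [S tau 0 - S tau s]: the former is [O(1 / a s)] because [a / adot] is monotone, the latter
    [O(a s ^ 2)], so the product vanishes. *)
Lemma f_norm_cvg0 tau : 0 < tau ->
  f_norm a tau s @[s --> 0^'+] --> f_norm a tau 0.
Proof.
move=> tau0; have at0 := scale_gt0 Ha tau0; have dt := adot_gt0 Ha tau0.
have n0 : `|0 : R| < tau by rewrite normr0.
have S0 := root_gap_gt0 Ha n0.
have S0E : S tau 0 = a tau.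
  rewrite /root_gap aevE// (scale0 Ha) expr0n/= subr0 sqrtr_sqr ger0_norm//.
  exact: ltW.
have kint := integrable_f_kernel Ha (lexx 0) tau0.
pose I s := \int[mu]_(t in `[0, s]) f_kernel a tau 0 t.
pose E s := `|I s| / S tau 0 + 2 * aev a s / (adot a tau * a tau * S tau s).
have bound s : 0 < s -> s < tau -> `|f_norm a tau 0 - f_norm a tau s| <= E s.
  move=> s0 st; have as0 := scale_gt0 Ha s0; have ds := adot_gt0 Ha s0.
  have ns : `|s| < tau by rewrite gtr0_norm.
  have Ss := root_gap_gt0 Ha ns.
  have sub : S tau 0 - S tau s <= a s ^+ 2 / S tau 0.
    rewrite ler_pdivlMr//.
    have := root_gap_sqr Ha ns; rewrite aevE ?(ltW s0)// S0E => e1.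
    have := root_gap_anti Ha tau (lexx 0) (ltW s0); rewrite S0E.
    by nra.
  have SS : S tau s <= S tau 0 by exact: (root_gap_anti Ha tau (lexx 0) (ltW s0)).
  (* Beyond [s] both terms contain the same integral of [w / S tau], which cancels. *)
  have -> : f_norm a tau 0 - f_norm a tau s = I s / S tau 0 +
      ((adot a s)^-1 - (adot a tau)^-1) * ((S tau 0 - S tau s) / (S tau 0 * S tau s)).
    rewrite (f_normE Ha s0 st) /f_norm (f_posE a tau (lexx 0)).
    rewrite (@Rintegral_segmentD _ _ 0 s tau) ?(ltW s0) ?(ltW st)//.
    rewrite (f_kernel_split Ha (lexx 0) s0 st) -/(I s).
    by field; rewrite !gt_eqF.
  apply: (le_trans (ler_normD _ _)); rewrite /E lerD//.
    by rewrite normrM [X in _ * X]ger0_norm// invr_ge0 ltW.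
  rewrite normrM [X in _ * X]ger0_norm; last first.
    by rewrite divr_ge0 ?subr_ge0// mulr_ge0// ltW.
  have dsb : (adot a s)^-1 <= a tau / adot a tau / a s.
    rewrite ler_pdivlMr// mulrC.
    exact: (scale_div_adot_le Ha s0 (ltW st)).
  have dtb : (adot a tau)^-1 <= a tau / adot a tau / a s.
    rewrite ler_pdivlMr// [leRHS]mulrC ler_pM2l ?invr_gt0//.
    exact: (scale_le Ha (ltW s0) (ltW st)).
  have W : `|(adot a s)^-1 - (adot a tau)^-1| <= 2 * (a tau / adot a tau / a s).
    have p1 : 0 < (adot a s)^-1 by rewrite invr_gt0.
    have p2 : 0 < (adot a tau)^-1 by rewrite invr_gt0.
    by rewrite ler_norml; lra.
  apply: (@le_trans _ _ (2 * (a tau / adot a tau / a s) *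
     (a s ^+ 2 / S tau 0 / (S tau 0 * S tau s)))).
    apply: ler_pM => //; first by rewrite divr_ge0 ?subr_ge0// mulr_ge0// ltW.
    by rewrite ler_pM2r// invr_gt0 mulr_gt0.
  rewrite (aevE _ (ltW s0)) S0E le_eqVlt; apply/orP; left; apply/eqP.
  by field; rewrite !gt_eqF.
have E0 : E s @[s --> 0^'+] --> (0 : R).
  have I0 : I s @[s --> 0^'+] --> (0 : R).
    have := parameterized_integral_continuous (ltW tau0) kint.
    move/(continuous_within_itvP _ tau0) => [_ + _].
    by rewrite /parameterized_integral set_itv1 Rintegral_set1.
  rewrite -[X in _ --> X](addr0 0); apply: cvgD.
    have I1 : `|I s| @[s --> 0^'+] --> (0 : R).
      by apply/norm_cvg0P.
    rewrite -[X in _ --> X](mul0r (S tau 0)^-1).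
    exact: cvgM I1 (cvg_cst _).
  have z0 : 2 * aev a 0 / (adot a tau * a tau * S tau 0) = 0.
    by rewrite aevE// (scale0 Ha) mulr0 mul0r.
  rewrite -[X in _ --> X]z0.
  apply: cvg_at_right_filter; apply: cvgM.
    by apply: cvgM; [exact: cvg_cst|exact: (continuous_aev Ha)].
  apply: cvgV; first by rewrite gt_eqF// !mulr_gt0.
  by apply: cvgM; [exact: cvg_cst|exact: (continuous_root_gap Ha)].
apply/cvgrPdist_lt => e e0; near=> s.
apply: le_lt_trans (bound s _ _) _; near: s.
- exact: nbhs_right_gt.
- exact: nbhs_right_lt.
- exact: cvgr_lt E0 _ e0.
Unshelve. all: end_near. Qed.

Lemma continuous_f_norm tau c : 0 < c -> c < tau ->
  {within `[0, c], continuous (f_norm a tau)}.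
Proof.
move=> c0 ct; have tau0 : 0 < tau by exact: lt_trans ct.
have cf s : 0 < s -> s < tau -> {for s, continuous (f_norm a tau)}.
  move=> s0 st; apply/differentiable_continuous/derivable1_diffP.
  by case: (is_derive_f_norm Ha s0 st).
apply/(continuous_within_itvP _ c0); split.
- by move=> t; rewrite in_itv/= => /andP[t0 tc]; apply: cf => //; exact: lt_trans ct.
- exact: f_norm_cvg0.
- by apply: cvg_at_left_filter; exact: cf.
Qed.

(** Mean value theorem; the sum [1 + adot t / adot tau] replaces the absolute difference, as either
    value of [adot] may be the larger. *)
Lemma f_norm_lipschitz tau c M x y : 0 < c -> c < tau ->
  (forall t, 0 < t < c -> a t / S tau t ^+ 3 * (1 + adot a t / adot a tau) <= M) ->
  0 <= x <= c -> 0 <= y <= c ->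
  `|f_norm a tau x - f_norm a tau y| <= M * `|x - y|.
Proof.
move=> c0 ct HM; have tau0 : 0 < tau by exact: lt_trans ct.
wlog xy : x y / x <= y.
  move=> H xc yc; have [xy|/ltW yx] := leP x y; first exact: H.
  by rewrite distrC (distrC x); exact: H.
move=> /andP[x0 _] /andP[_ yc]; move: xy; rewrite le_eqVlt => /predU1P[->|xy].
  by rewrite !subrr normr0 mulr0.
have [t||z] := @MVT _ (f_norm a tau)
    (fun s => - (a s / S tau s ^+ 3 * (1 - adot a s / adot a tau))) x y xy.
- rewrite in_itv/= => /andP[xt ty].
  apply: (is_derive_f_norm Ha); first exact: le_lt_trans xt.
  exact: lt_trans (lt_le_trans ty yc) ct.
- apply: continuous_subspaceW (continuous_f_norm c0 ct) => t.
  by rewrite /= !in_itv/= => /andP[xt ty]; rewrite (le_trans x0)// (le_trans ty).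
rewrite in_itv/= => /andP[xz zy] E.
have z0 : 0 < z by exact: le_lt_trans xz.
have zc : z < c by exact: lt_le_trans yc.
rewrite distrC E normrM (distrC x) ler_wpM2r// normrN normrM.
apply: le_trans (HM z _); last by rewrite z0.
have S0 : 0 < S tau z by rewrite (root_gap_gt0 Ha)// gtr0_norm// (lt_trans zc).
have az := scale_gt0 Ha z0.
rewrite ger0_norm; last by rewrite divr_ge0 ?exprn_ge0// ltW.
rewrite ler_wpM2l//; first by rewrite divr_ge0 ?exprn_ge0// ltW.
apply: (le_trans (ler_normB _ _)); rewrite normr1 lerD2l ger0_norm//.
by rewrite divr_ge0// ltW// (adot_gt0 Ha).
Qed.

Lemma continuous_f_pos_tau tau s : 0 <= s -> s < tau ->
  {for tau, continuous (fun x => f_pos a x s)}.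
Proof.
move=> s0 st; have [K K0 wK] := rel_accel_bound Ha.
(* Restricting to endpoints [x > u] gives [S x s >= S u s > 0], hence the uniform constant
   [K / S u s]. *)
pose u := (s + tau) / 2.
have [su ut] : s < u /\ u < tau by rewrite /u; split; lra.
have u0 : 0 < u by exact: le_lt_trans su.
have nu : `|s| < u by rewrite ger0_norm.
have Su := root_gap_gt0 Ha nu.
have -> : f_pos a ^~ s = fun x => \int[mu]_(t in `[s, x]) f_kernel a x s t.
  by apply/funext => x; exact: f_posE.
apply: (@dominated_endpoint_continuous _ _ Ha (fun x t => f_kernel a x s t)
  s tau u (tau + 1) (K / S u s)) => //.
- exact: ltW.
- by rewrite ut /= ltrDl ltr01.
- by rewrite divr_gt0.
- by move=> x /andP[ux _] t; apply: (continuous_f_kernel Ha) => //; exact: lt_trans ux.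
- move=> x t /andP[ux _] /andP[stt tx]; have t0 : 0 < t by exact: le_lt_trans stt.
  apply: le_trans (f_kernel_bound Ha (ltW K0) (wK _ t0) s0 stt tx) _.
  apply: ler_wpM2r; first by rewrite divr_ge0 ?(aev_ge0 Ha)// sqrtr_ge0.
  have SS : S u s <= S x s by apply: (root_gap_mono Ha); exact: ltW.
  by rewrite ler_pM2l// lef_pV2 ?posrE// (lt_le_trans Su).
- move=> x t /andP[ux _] /andP[stt tx]; have t0 : 0 < t by exact: le_lt_trans stt.
  have x0 : 0 < x by exact: lt_trans ux.
  apply: cvgM; first exact: cvg_cst.
  apply: cvgB; last exact: cvg_cst.
  have cS r : {for x, continuous (S^~ r)}.
    by apply: (@root_gap_cvg _ _ Ha _ _ _ id (cst r)) => //; exact: cvg_cst.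
  apply: cvgM; first exact: cS.
  by apply: cvgV; [rewrite gt_eqF// (root_gap_gt0 Ha)// gtr0_norm|exact: cS].
Qed.

Lemma continuous_f_norm_tau tau s : 0 <= s -> s < tau ->
  {for tau, continuous (fun x => f_norm a x s)}.
Proof.
move=> s0 st; apply: cvgM; first exact: continuous_f_pos_tau.
apply: cvgV; first by rewrite gt_eqF// (root_gap_gt0 Ha)// ger0_norm.
apply: (@root_gap_cvg _ _ Ha _ _ _ id (cst s)) => //; last exact: cvg_cst.
exact: le_lt_trans st.
Qed.

Variable L : R.
Hypothesis HL : adot a t @[t --> 0^'+] --> L.

(** Even in [t], whereas the derivative of [aev a] is odd: the formula for the derivative in [rho]
    involves [adot] at the absolute value of [t0]. *)
Definition adot_ext t : R := if t == 0 then L else adot a `|t|.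

Lemma continuous_adot_ext : continuous adot_ext.
Proof.
move=> t; have [->|t0] := eqVneq t 0.
- rewrite /continuous_at {2}/adot_ext eqxx; apply/cvgrPdist_lt => e e0.
  move/cvgrPdist_lt : HL => /(_ _ e0)[d /= d0 dP].
  exists d => //= x /=; rewrite sub0r normrN => xd; rewrite /adot_ext.
  have [x0|x0] := eqVneq x 0; first by rewrite subrr normr0.
  by apply: dP; rewrite /= ?sub0r ?normrN ?normr_id ?normr_gt0.
- apply: (@cvg_trans _ (adot a `|x| @[x --> t])).
    apply: near_eq_cvg; near=> x; rewrite /adot_ext ifF//; apply/negbTE.
    by near: x; exact: open_neq.
  rewrite /adot_ext (negbTE t0).
  have nt : `|x| @[x --> t] --> `|t| by exact: norm_continuous.
  by apply: (cvg_comp _ (adot a) nt); apply: (continuous_adot Ha); rewrite normr_gt0.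
Unshelve. all: end_near. Qed.

(** The finite limit at [0] allows maximizing the continuous extension over a compact segment;
    [adot] itself need not be monotone. *)
Lemma adot_bounded c : 0 < c -> exists A, forall t, 0 < t < c -> adot a t <= A.
Proof.
move=> c0; have [|m _ mP] := @EVT_max _ adot_ext 0 c (ltW c0).
  by apply: continuous_subspaceT => x; exact: continuous_adot_ext.
exists (adot_ext m) => t /andP[t0 tc].
have := mP t; rewrite in_itv/= (ltW t0) (ltW tc) => /(_ isT).
by rewrite {1}/adot_ext gt_eqF// gtr0_norm.
Qed.

(* Lipschitz in [s] uniformly in [tau], together with continuity in [tau]. *)
Lemma f_norm_cvg {T : Type} (F : set_system T) {FF : Filter F} (f g : T -> R) tau s :
  0 <= s -> s < tau -> f @ F --> tau -> g @ F --> s -> (\forall z \near F, 0 <= g z) ->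
  f_norm a (f z) (g z) @[z --> F] --> f_norm a tau s.
Proof.
move=> s0 st fF gF g0; have tau0 : 0 < tau by exact: le_lt_trans st.
(* Eventually [g z < c] and [c' < f z]; the gap between [c] and [c'] bounds [S (f z)] from below on
   []0, c[], which gives one Lipschitz constant for all nearby [z]. *)
pose c := (s + tau) / 2; pose c' := (c + tau) / 2.
have [sc cc' c't] : [/\ s < c, c < c' & c' < tau] by rewrite /c' /c; split; lra.
have c0 : 0 < c by exact: le_lt_trans sc.
have nc : `|c| < c' by rewrite gtr0_norm.
have Sc := root_gap_gt0 Ha nc.
have dt := adot_gt0 Ha tau0.
have [A HA] := adot_bounded c0.
pose m := adot a tau / 2.
have m0 : 0 < m by rewrite divr_gt0.
pose M := a c / S c' c ^+ 3 * (1 + A / m).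
have df : adot a (f z) @[z --> F] --> adot a tau.
  by apply: (cvg_comp _ (adot a) fF); exact: (continuous_adot Ha).
have mt : m < adot a tau by rewrite /m; lra.
have lip : \forall z \near F, `|f_norm a (f z) s - f_norm a (f z) (g z)| <= M * `|s - g z|.
  near=> z.
  have fz : c' < f z by near: z; exact: cvgr_gt fF _ c't.
  have gz : g z < c by near: z; exact: cvgr_lt gF _ sc.
  have gz0 : 0 <= g z by near: z.
  have mz : m < adot a (f z) by near: z; exact: cvgr_gt df _ mt.
  apply: (@f_norm_lipschitz _ c) => //.
  - exact: lt_trans fz.
  - move=> t /[dup] /HA At /andP[t0 tc].
    have S1 : S c' c <= S (f z) t.
      apply: le_trans (root_gap_anti Ha (f z) (ltW t0) (ltW tc)).
      exact: (root_gap_mono Ha c (ltW (lt_trans c0 cc')) (ltW fz)).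
    have adt := adot_gt0 Ha t0.
    apply: ler_pM.
    + by rewrite divr_ge0 ?exprn_ge0 ?sqrtr_ge0// ltW// (scale_gt0 Ha).
    + by rewrite addr_ge0// divr_ge0 ?(ltW adt)// ltW// (lt_trans m0).
    + apply: ler_pM; first by rewrite ltW// (scale_gt0 Ha).
      * by rewrite invr_ge0 exprn_ge0// sqrtr_ge0.
      * by rewrite (scale_le Ha) ?ltW.
      * rewrite lef_pV2 ?posrE ?exprn_gt0// ?(lt_le_trans Sc)//.
        by rewrite lerXn2r// nnegrE sqrtr_ge0.
    + rewrite lerD2l; apply: ler_pM => //; first exact: ltW.
        by rewrite invr_ge0 ltW// (lt_trans m0).
      by rewrite lef_pV2 ?posrE ?(ltW mz)// (lt_trans m0).
  - by rewrite s0 ltW.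
  - by rewrite gz0 ltW.
have fs : f_norm a (f z) s @[z --> F] --> f_norm a tau s.
  by apply: (cvg_comp f (f_norm a ^~ s) fF); exact: continuous_f_norm_tau.
have M0 : M * `|s - g z| @[z --> F] --> (0 : R).
  rewrite -[X in _ --> X](mulr0 M); apply: cvgM; first exact: cvg_cst.
  by apply/(norm_cvg0P (fun z => s - g z)); rewrite -(subrr s); apply: cvgB => //; exact: cvg_cst.
apply/cvgrPdist_lt => e e0; have e2 : 0 < e / 2 by rewrite divr_gt0.
near=> z.
have l1 : `|f_norm a (f z) s - f_norm a (f z) (g z)| <= M * `|s - g z| by near: z.
have l2 : M * `|s - g z| < e / 2 by near: z; exact: cvgr_lt M0 _ e2.
have l3 : `|f_norm a tau s - f_norm a (f z) s| < e / 2.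
  by near: z; move/cvgrPdist_lt : fs; exact.
have -> : f_norm a tau s - f_norm a (f z) (g z) = (f_norm a tau s - f_norm a (f z) s)
  + (f_norm a (f z) s - f_norm a (f z) (g z)) by rewrite addrA subrK.
by apply: le_lt_trans (ler_normD _ _) _; lra.
Unshelve. all: end_near. Qed.

End JointContinuity.

(** * The positive part, used to glue functions at [0] *)

Section PositivePart.
Context {R : realType}.
Implicit Types t : R.

Definition pos_part t : R := (`|t| + t) / 2.

Lemma pos_part_ge0 t : 0 <= pos_part t.
Proof. by rewrite /pos_part; have := ler_norm (- t); rewrite normrN; lra. Qed.

Lemma pos_part_id t : 0 <= t -> pos_part t = t.
Proof. by move=> t0; rewrite /pos_part ger0_norm//; lra. Qed.

Lemma pos_part_eq0 t : t <= 0 -> pos_part t = 0.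
Proof. by move=> t0; rewrite /pos_part ler0_norm//; lra. Qed.

Lemma pos_part_cvg {T : Type} (F : set_system T) {FF : Filter F} (g : T -> R) t :
  g @ F --> t -> pos_part (g z) @[z --> F] --> pos_part t.
Proof.
move=> gF; apply: cvgM; last exact: cvg_cst.
by apply: cvgD => //; exact: cvg_norm.
Qed.

Lemma pos_part_lt t x : `|t| < x -> pos_part t < x.
Proof.
move=> tx; have [t0|/ltW t0] := leP 0 t; last first.
  by rewrite pos_part_eq0// (le_lt_trans _ tx).
by rewrite pos_part_id// (le_lt_trans _ tx)// ler_norm.
Qed.

End PositivePart.

(** * The coordinate [t0] obtained by inverting [rho] *)

Section TimeCoordinate.
Context {R : realType} (a : R -> R).
Hypothesis Ha : strongly_regular_scale_factor a.
Implicit Types (s t tau x y rho : R).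
Local Notation P := (rho_fun a).

(* The reflection formula for [t < 0] and the plain value for [t >= 0] at once. *)
Definition reflect_ext (h : R -> R) t : R :=
  h (pos_part t) - h (pos_part (- t)) + h 0.

Lemma reflect_ext_ge0 h t : 0 <= t -> reflect_ext h t = h t.
Proof.
move=> t0; rewrite /reflect_ext pos_part_id// pos_part_eq0 ?oppr_le0//.
by rewrite subrK.
Qed.

Lemma reflect_ext_le0 h t : t <= 0 -> reflect_ext h t = 2 * h 0 - h (- t).
Proof.
move=> t0; rewrite /reflect_ext pos_part_eq0// pos_part_id ?oppr_ge0//.
by ring.
Qed.

Lemma rho_int_reflect tau t : `|t| < tau ->
  rho_int a tau t = (reflect_ext (P tau) t)%:E.
Proof.
have [t0|/ltW t0] := leP 0 t.
  by rewrite ger0_norm// => tt; rewrite reflect_ext_ge0// (rho_intE Ha).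
rewrite ler0_norm// => tt; rewrite reflect_ext_le0//.
by rewrite -{1}(opprK t) (rho_intN Ha)// oppr_ge0.
Qed.

Lemma ff_reflect tau t : ff a tau t = reflect_ext (f_pos a tau) t.
Proof.
rewrite /ff; case: ifPn => [t0|]; first by rewrite reflect_ext_ge0.
by rewrite -ltNge => /ltW t0; rewrite reflect_ext_le0.
Qed.

Lemma rho_fun_ge tau x y : 0 <= x -> x <= y -> y < tau -> P tau y <= P tau x.
Proof.
move=> x0; rewrite le_eqVlt => /predU1P[->//|xy] yt.
exact/ltW/(rho_fun_lt Ha).
Qed.

Lemma pos_part_le x y : x <= y -> pos_part x <= pos_part y.
Proof.
move=> xy; have [x0|/ltW x0] := leP 0 x.
  by rewrite !pos_part_id// (le_trans x0).
by rewrite pos_part_eq0// pos_part_ge0.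
Qed.

(** Both variable terms of [reflect_ext] are weakly decreasing; the reflected one is strict when
    [y <= 0], the plain one when [y > 0]. *)
Lemma reflect_rho_lt tau x y : `|x| < tau -> `|y| < tau -> x < y ->
  reflect_ext (P tau) y < reflect_ext (P tau) x.
Proof.
move=> xt yt xy; rewrite /reflect_ext ltrD2r.
have nxt : `|- x| < tau by rewrite normrN.
have nyt : `|- y| < tau by rewrite normrN.
have nyx : - y <= - x by rewrite lerN2 ltW.
have h1 := rho_fun_ge (pos_part_ge0 _) (pos_part_le (ltW xy)) (pos_part_lt yt).
have h2 := rho_fun_ge (pos_part_ge0 _) (pos_part_le nyx) (pos_part_lt nxt).
have [y0|y0] := leP y 0.
  have : P tau (pos_part (- x)) < P tau (pos_part (- y)).
    apply: (rho_fun_lt Ha (pos_part_ge0 _) _ (pos_part_lt nxt)).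
    by rewrite !pos_part_id ?oppr_ge0 ?ltrN2// ltW// (lt_le_trans xy).
  by lra.
have : P tau (pos_part y) < P tau (pos_part x).
  apply: (rho_fun_lt Ha (pos_part_ge0 _) _ (pos_part_lt yt)).
  rewrite (pos_part_id (ltW y0)); have [x0|/ltW x0] := leP 0 x.
    by rewrite pos_part_id.
  by rewrite pos_part_eq0.
by lra.
Qed.

Lemma DdomE p : Ddom a p <-> [/\ 0 < p.1, 0 < p.2 & p.2 < 2 * P p.1 0].
Proof.
split=> [[p1 [p2]]|[p1 p2 p3]].
  by rewrite /rhoM (rho_intE Ha)// -EFinM lte_fin.
by split=> //; split=> //; rewrite /rhoM (rho_intE Ha)// -EFinM lte_fin.
Qed.

Lemma rho_fun_self tau : P tau tau = 0.
Proof. by rewrite /rho_fun set_itv1 Rintegral_set1. Qed.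

Lemma rho_fun_surj tau rho : 0 < tau -> 0 < rho <= P tau 0 ->
  exists2 s, 0 <= s < tau & P tau s = rho.
Proof.
move=> tau0 /andP[r0 rP].
have [|s] := @IVT _ (P tau) 0 tau rho (ltW tau0) (continuous_rho Ha tau0).
  by rewrite rho_fun_self ge_min le_max rP (ltW r0) orbT.
rewrite in_itv/= => /andP[s0 st] Ps; exists s => //.
rewrite s0 lt_neqAle st andbT; apply: contraTneq r0 => sE.
by rewrite -Ps sE rho_fun_self ltxx.
Qed.

Lemma t0f_spec p : Ddom a p ->
  `|t0f a p.1 p.2| < p.1 /\ reflect_ext (P p.1) (t0f a p.1 p.2) = p.2.
Proof.
move=> /DdomE[p1 p2 p3]; set tau := p.1 in p1 p3 *; set rho := p.2 in p2 p3 *.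
suff ex : exists t, - tau < t < tau /\ rho%:E = rho_int a tau t.
  have [] := xgetPex (0 : R) ex; rewrite -/(t0f a tau rho) -ltr_norml => tt.
  by rewrite rho_int_reflect// => -[<-].
have P0 : rho <= P tau 0 \/ P tau 0 <= rho by apply/orP; exact: le_total.
case: P0 => rP.
  have [|s /andP[s0 st] Ps] := @rho_fun_surj tau rho p1; first by rewrite p2.
  exists s; rewrite (rho_intE Ha)// Ps; split=> //.
  by rewrite st andbT (lt_le_trans _ s0)// oppr_lt0.
(* Past [P tau 0] the time is negative, and the reflected distance [2 * P tau 0 - rho] is positive
   by the definition of [Ddom]. *)
have [|s /andP[s0 st] Ps] := @rho_fun_surj tau (2 * P tau 0 - rho) p1; first by lra.
exists (- s); rewrite (rho_intN Ha)// Ps; split; last by congr (_%:E); ring.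
by rewrite ltrN2 st (le_lt_trans _ p1)// oppr_le0.
Qed.

Lemma reflect_rho_cvg tau t : `|t| < tau ->
  {for tau, continuous (fun x => reflect_ext (P x) t)}.
Proof.
move=> tt; have tau0 : 0 < tau by exact: le_lt_trans tt.
have ntt : `|- t| < tau by rewrite normrN.
apply: cvgD; last exact: (continuous_rho_tau Ha).
by apply: cvgB; apply: (continuous_rho_tau Ha); rewrite ?pos_part_ge0// pos_part_lt.
Qed.

(** An implicit function argument by monotonicity, as the derivative of [rho] in [t0] vanishes at
    [0]: strict inequalities at two fixed times around [t0] persist for nearby points of the domain
    and trap the solution between them. *)
Lemma t0f_cvg p : Ddom a p ->
  t0f a q.1 q.2 @[q --> within (Ddom a) (nbhs p)] --> t0f a p.1 p.2.
Proof.
move=> Dp; have [tt te] := t0f_spec Dp; set s := t0f _ _ _ in tt te *.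
have [p1 p2 p3] := (DdomE p).1 Dp.
have c1 : q.1 @[q --> within (Ddom a) (nbhs p)] --> p.1.
  by apply: cvg_within_filter; exact: cvg_fst.
have c2 : q.2 @[q --> within (Ddom a) (nbhs p)] --> p.2.
  by apply: cvg_within_filter; exact: cvg_snd.
have cr t : `|t| < p.1 -> reflect_ext (P q.1) t @[q --> within (Ddom a) (nbhs p)] -->
    reflect_ext (P p.1) t.
  by move=> tp; apply: (cvg_comp _ (fun x => reflect_ext (P x) t) c1); exact: reflect_rho_cvg.
apply/cvgrPdist_lt => e e0.
have [st1 st2] : - p.1 < s /\ s < p.1 by apply/andP; rewrite -ltr_norml.
(* The second entry is the midpoint of [s] and [- p.1], which keeps [t1] inside the admissible
   interval; [t2] is chosen symmetrically. *)
pose t1 := Num.max (s - e / 2) ((s - p.1) / 2).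
pose t2 := Num.min (s + e / 2) ((s + p.1) / 2).
have t1s : t1 < s by rewrite gt_max; lra.
have t2s : s < t2 by rewrite lt_min; lra.
have t1e : s - e < t1 by rewrite lt_max; apply/orP; left; lra.
have t2e : t2 < s + e by rewrite gt_min; apply/orP; left; lra.
have t1p : `|t1| < p.1.
  rewrite ltr_norml (lt_trans t1s st2) andbT lt_max; apply/orP; right; lra.
have t2p : `|t2| < p.1.
  by rewrite ltr_norml (lt_trans st1 t2s)/= gt_min; apply/orP; right; lra.
have r1 : p.2 < reflect_ext (P p.1) t1 by rewrite -te; exact: reflect_rho_lt.
have r2 : reflect_ext (P p.1) t2 < p.2 by rewrite -te; exact: reflect_rho_lt.
have near1 : \forall q \near within (Ddom a) (nbhs p), q.2 < reflect_ext (P q.1) t1.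
  have c3 : reflect_ext (P q.1) t1 - q.2 @[q --> within (Ddom a) (nbhs p)] -->
    reflect_ext (P p.1) t1 - p.2 by apply: cvgB => //; exact: cr.
  have r0 : 0 < reflect_ext (P p.1) t1 - p.2 by rewrite subr_gt0.
  by near=> q; rewrite -subr_gt0; near: q; exact: cvgr_gt c3 _ r0.
have near2 : \forall q \near within (Ddom a) (nbhs p), reflect_ext (P q.1) t2 < q.2.
  have c3 : q.2 - reflect_ext (P q.1) t2 @[q --> within (Ddom a) (nbhs p)] -->
    p.2 - reflect_ext (P p.1) t2 by apply: cvgB => //; exact: cr.
  have r0 : 0 < p.2 - reflect_ext (P p.1) t2 by rewrite subr_gt0.
  by near=> q; rewrite -subr_gt0; near: q; exact: cvgr_gt c3 _ r0.
have nearD : \forall q \near within (Ddom a) (nbhs p), Ddom a q by exact: withinT.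
near=> q.
have Dq : Ddom a q by near: q.
have [qt qe] := t0f_spec Dq.
have q1 : `|t1| < q.1 by near: q; exact: cvgr_gt c1 _ t1p.
have q2 : `|t2| < q.1 by near: q; exact: cvgr_gt c1 _ t2p.
have n1 : q.2 < reflect_ext (P q.1) t1 by near: q.
have n2 : reflect_ext (P q.1) t2 < q.2 by near: q.
have lt1 : t1 < t0f a q.1 q.2.
  rewrite ltNge le_eqVlt; apply/negP => /predU1P[E|lt].
    by move: n1; rewrite -E qe ltxx.
  by have := reflect_rho_lt qt q1 lt; rewrite qe ltNge (ltW n1).
have lt2 : t0f a q.1 q.2 < t2.
  rewrite ltNge le_eqVlt; apply/negP => /predU1P[E|lt].
    by move: n2; rewrite E qe ltxx.
  by have := reflect_rho_lt q2 qt lt; rewrite qe ltNge (ltW n2).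
by rewrite ltr_norml; lra.
Unshelve. all: end_near. Qed.

End TimeCoordinate.

(** * The derivative in [rho] and its continuity *)

Section Derivative.
Context {R : realType} (a : R -> R) (L : R).
Hypothesis Ha : strongly_regular_scale_factor a.
Hypothesis HL : adot a t @[t --> 0^'+] --> L.
Implicit Types (s t tau x y rho : R).
Local Notation S := (root_gap a).
Local Notation P := (rho_fun a).

(* The quotient of [d f / d t0] by [d rho / d t0]: both vanish at [t0 = 0], where
   the quotient nevertheless extends continuously. *)
Definition df_drho tau t : R :=
  adot_ext a L t * f_norm a tau `|t| + (1 - adot_ext a L t / adot a tau) / S tau t.
Local Notation Q := df_drho.

Lemma df_drhoN tau t : Q tau (- t) = Q tau t.
Proof. by rewrite /df_drho /adot_ext normrN oppr_eq0 -root_gap_norm normrN root_gap_norm. Qed.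

Lemma df_drho_cvg {T : Type} (F : set_system T) {FF : Filter F} (f g : T -> R) tau t :
  `|t| < tau -> f @ F --> tau -> g @ F --> t -> Q (f z) (g z) @[z --> F] --> Q tau t.
Proof.
move=> tt fF gF; have tau0 : 0 < tau by exact: le_lt_trans tt.
have cl : adot_ext a L (g z) @[z --> F] --> adot_ext a L t.
  by apply: (cvg_comp _ (adot_ext a L) gF); exact: continuous_adot_ext.
apply: cvgD.
  apply: cvgM => //; apply: (f_norm_cvg Ha HL) => //; first exact: cvg_norm.
  by near=> z; exact: normr_ge0.
apply: cvgM.
  apply: cvgB; first exact: cvg_cst.
  apply: cvgM => //; apply: cvgV; first by rewrite gt_eqF// (adot_gt0 Ha).
  by apply: (cvg_comp _ (adot a) fF); exact: (continuous_adot Ha).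
apply: cvgV; first by rewrite gt_eqF// (root_gap_gt0 Ha).
exact: (root_gap_cvg Ha).
Unshelve. all: end_near. Qed.

Lemma f_pos_norm tau s : 0 <= s -> s < tau -> f_pos a tau s = f_norm a tau s * S tau s.
Proof.
move=> s0 st; rewrite /f_norm divfK// gt_eqF// (root_gap_gt0 Ha)//.
by rewrite ger0_norm.
Qed.

(** Product rule for [f_norm * S]: both terms contain [- (a s / S tau s)], the derivative of [P],
    and the cofactor is [Q]. *)
Lemma is_derive_f_pos tau s : 0 < s -> s < tau ->
  is_derive s 1 (f_pos a tau) (Q tau s * - (a s / S tau s)).
Proof.
move=> s0 st; have tau0 : 0 < tau by exact: lt_trans st.
have S0 : 0 < S tau s by rewrite (root_gap_gt0 Ha)// gtr0_norm.
have dt := adot_gt0 Ha tau0.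
have d1 := is_derive_f_norm Ha s0 st; have d2 := is_derive_root_gap Ha s0 st.
have dM : is_derive s 1 (f_norm a tau * S tau) (Q tau s * - (a s / S tau s)).
  apply: is_derive_eq; rewrite /GRing.scale/= /df_drho /adot_ext gt_eqF// gtr0_norm//.
  by field; rewrite !gt_eqF.
apply: near_eq_is_derive dM; near=> x.
rewrite f_pos_norm//; first by near: x; exact: lt_le_nbhsr.
by near: x; exact: lt_nbhsl.
Unshelve. all: end_near. Qed.

(** Phrased as a first-order expansion instead of a quotient, so that estimates on both sides of [0]
    can be added and [x = y] is allowed. *)
Lemma f_pos_rho_increment tau x y q e : 0 <= x -> x <= y -> y < tau ->
  (forall t, x < t < y -> `|Q tau t - q| <= e) ->
  `|(f_pos a tau y - f_pos a tau x) - q * (P tau y - P tau x)| <=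
     e * (P tau x - P tau y).
Proof.
move=> x0; rewrite le_eqVlt => /predU1P[->|xy] yt Qe.
  by rewrite !subrr mulr0 subrr normr0 mulr0.
have tau0 : 0 < tau by exact: le_lt_trans (ltW (le_lt_trans x0 xy)) yt.
have y0 : 0 < y by exact: le_lt_trans xy.
have in0 t : t \in `]x, y[ -> 0 < t /\ t < tau.
  by rewrite in_itv/= => /andP[xt ty]; rewrite (le_lt_trans x0 xt) (lt_trans ty yt).
have cP : {within `[x, y], continuous (P tau)}.
  apply: continuous_subspaceW (continuous_rho Ha tau0) => t.
  by rewrite /= !in_itv/= => /andP[xt ty]; rewrite (le_trans x0 xt) (le_trans ty (ltW yt)).
have cf : {within `[x, y], continuous (f_pos a tau)}.
  have cM : {within `[x, y], continuous (fun s => f_norm a tau s * S tau s)}.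
    have c1 := continuous_f_norm Ha y0 yt.
    have c2 : {within `[x, y], continuous (f_norm a tau)}.
      apply: continuous_subspaceW c1 => t.
      by rewrite /= !in_itv/= => /andP[xt ->]; rewrite (le_trans x0 xt).
    have c3 : {within `[x, y], continuous (S tau)}.
      by apply: continuous_subspaceT; exact: (continuous_root_gap Ha).
    by move=> t; apply: cvgM; [exact: c2|exact: c3].
  apply: subspace_eq_continuous cM => t; rewrite inE/= in_itv/= => /andP[xt ty].
  rewrite /from_subspace f_pos_norm//; first exact: le_trans xt.
  exact: le_lt_trans yt.
have Plt := rho_fun_lt Ha x0 xy yt.
have [|||c cxy E] := @cauchy_MVT _ (f_pos a tau) (fun t => Q tau t * - (a t / S tau t))
    (P tau) (fun t => - (a t / S tau t)) x y xy cf cP.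
- by move=> t /in0[t0 tt]; exact: is_derive_f_pos.
- by move=> t /in0[t0 tt]; exact: (is_derive_rho Ha).
- move=> t /in0[t0 tt]; rewrite oppr_eq0 gt_eqF// divr_gt0 ?(scale_gt0 Ha)//.
  by rewrite (root_gap_gt0 Ha)// gtr0_norm.
have [c0 ct] := in0 _ cxy.
have n0 : - (a c / S tau c) != 0.
  rewrite oppr_eq0 gt_eqF// divr_gt0 ?(scale_gt0 Ha)//.
  by rewrite (root_gap_gt0 Ha)// gtr0_norm.
rewrite mulfK// in E.
have d0 : P tau y - P tau x != 0 by rewrite subr_eq0 lt_eqF.
have -> : f_pos a tau y - f_pos a tau x = Q tau c * (P tau y - P tau x).
  by rewrite E divfK.
rewrite -mulrBl normrM distrC [`|P tau y - _|]distrC.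
rewrite [`|P tau x - _|]gtr0_norm ?subr_gt0// ler_pM2r ?subr_gt0// distrC.
by apply: Qe; rewrite in_itv in cxy.
Qed.

(** The increment is the sum of one over the positive part of [[x, y]] and one over the mirrored
    negative part, where evenness of [Q] transports the hypothesis. *)
Lemma reflect_increment tau x y q e : `|x| < tau -> `|y| < tau -> x <= y ->
  (forall t, x < t < y -> `|Q tau t - q| <= e) ->
  `|(reflect_ext (f_pos a tau) y - reflect_ext (f_pos a tau) x) -
      q * (reflect_ext (P tau) y - reflect_ext (P tau) x)| <=
    e * (reflect_ext (P tau) x - reflect_ext (P tau) y).
Proof.
move=> xt yt xy Qe.
have nxt : `|- x| < tau by rewrite normrN.
have nyx : - y <= - x by rewrite lerN2.
have h1 := @f_pos_rho_increment tau _ _ q e (pos_part_ge0 _) (pos_part_le xy) (pos_part_lt yt).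
have h2 := @f_pos_rho_increment tau _ _ q e (pos_part_ge0 _) (pos_part_le nyx) (pos_part_lt nxt).
have {}h1 := h1 _; have {}h2 := h2 _.
have g1 t : pos_part x < t < pos_part y -> `|Q tau t - q| <= e.
  move=> /andP[xt1 ty1]; apply: Qe.
  have x1 : x <= pos_part x by rewrite /pos_part; have := ler_norm x; lra.
  rewrite (le_lt_trans x1 xt1)/=.
  have [y0|y0] := leP 0 y; first by move: ty1; rewrite pos_part_id.
  move: ty1; rewrite (pos_part_eq0 (ltW y0)) => t0.
  by have := lt_trans (le_lt_trans (pos_part_ge0 x) xt1) t0; rewrite ltxx.
have g2 t : pos_part (- y) < t < pos_part (- x) -> `|Q tau t - q| <= e.
  move=> /andP[xt1 ty1]; rewrite -df_drhoN; apply: Qe.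
  have y1 : - y <= pos_part (- y) by rewrite /pos_part; have := ler_norm (- y); lra.
  rewrite ltrNl (le_lt_trans y1 xt1) andbT ltrNr.
  have [x0|x0] := leP x 0; first by move: ty1; rewrite pos_part_id ?oppr_ge0.
  have nx0 : - x <= 0 by rewrite oppr_le0 ltW.
  move: ty1; rewrite (pos_part_eq0 nx0) => t0.
  by have := lt_trans (le_lt_trans (pos_part_ge0 (- y)) xt1) t0; rewrite ltxx.
have {}h1 := h1 g1; have {}h2 := h2 g2.
rewrite /reflect_ext.
set A1 := f_pos _ _ (pos_part y) in h1 *; set A2 := f_pos _ _ (pos_part x) in h1 *.
set A3 := f_pos _ _ (pos_part (- x)) in h2 *; set A4 := f_pos _ _ (pos_part (- y)) in h2 *.
set B1 := P _ (pos_part y) in h1 *; set B2 := P _ (pos_part x) in h1 *.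
set B3 := P _ (pos_part (- x)) in h2 *; set B4 := P _ (pos_part (- y)) in h2 *.
set A0 := f_pos _ _ 0; set B0 := P _ 0.
have -> : A1 - A4 + A0 - (A2 - A3 + A0) - q * (B1 - B4 + B0 - (B2 - B3 + B0)) =
  (A1 - A2 - q * (B1 - B2)) + (A3 - A4 - q * (B3 - B4)) by ring.
have -> : e * (B2 - B3 + B0 - (B1 - B4 + B0)) = e * (B2 - B1) + e * (B4 - B3) by ring.
by apply: le_trans (ler_normD _ _) _; exact: lerD.
Qed.

(** The derivative in [rho] looks at a full neighbourhood, while [t0f] obeys its specification only
    on the domain. *)
Lemma near_Ddom_slice tau rho : Ddom a (tau, rho) ->
  \forall r \near rho, Ddom a (tau, r).
Proof.
move=> /(DdomE Ha)[/= p1 p2 p3]; near=> r; apply/(DdomE Ha); split => //=; near: r.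
- exact: lt_nbhsr.
- exact: lt_nbhsl.
Unshelve. all: end_near. Qed.

Lemma t0f_slice_cvg tau rho : Ddom a (tau, rho) ->
  t0f a tau r @[r --> rho] --> t0f a tau rho.
Proof.
move=> Dp.
have slice : (tau, r) @[r --> rho] --> within (Ddom a) (nbhs (tau, rho)).
  have pair : (tau, r) @[r --> rho] --> (nbhs tau, nbhs rho).
    by apply: cvg_pair; [exact: cvg_cst|exact: cvg_id].
  move=> A wA; change (\forall r \near rho, A (tau, r)).
  have near1 := near_Ddom_slice Dp.
  have near2 : \forall r \near rho, Ddom a (tau, r) -> A (tau, r) by exact: pair _ wA.
  by apply: filterS2 near1 near2 => r Dr; exact.
exact: (cvg_comp _ (fun q => t0f a q.1 q.2) slice (t0f_cvg Ha Dp)).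
Qed.

(** The chain rule through [t0] fails at [t0 = 0], where its slope in [rho] is infinite.
    Carathéodory's criterion reduces the claim to continuity at [rho] of the difference quotient
    completed by [Q]. *)
Lemma is_derive_ff_t0f tau rho : Ddom a (tau, rho) ->
  is_derive rho 1 (fun r => ff a tau (t0f a tau r)) (Q tau (t0f a tau rho)).
Proof.
move=> Dp; have [p1 p2 p3] := (DdomE Ha (tau, rho)).1 Dp.
have [/= tt te] := t0f_spec Ha Dp; rewrite /= in p1 p2 p3.
set s := t0f a tau rho in tt te *.
pose G r := ff a tau (t0f a tau r).
apply/is_derive1_caratheodory.
exists (fun r => if r == rho then Q tau s else (G r - G rho) / (r - rho)); split.
- move=> r; have [->|rr] := eqVneq r rho; first by rewrite !subrr mulr0.
  by rewrite divfK// subr_eq0.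
- rewrite /prop_for /continuous_at eqxx; apply/cvgrPdist_le => e e0.
  have cQ : Q tau t @[t --> s] --> Q tau s.
    by apply: (@df_drho_cvg _ _ _ (cst tau) id) => //; exact: cvg_cst.
  move/cvgrPdist_le : cQ => /(_ _ e0)[d /= d0 dP].
  have nearD := near_Ddom_slice Dp.
  near=> r.
  have [_|rr] := eqVneq r rho; first by rewrite subrr normr0 ltW.
  have Dr : Ddom a (tau, r) by near: r.
  have [/= rt re] := t0f_spec Ha Dr.
  have close : `|s - t0f a tau r| < d.
    by near: r; move/cvgrPdist_lt : (t0f_slice_cvg Dp); exact.
  have key : `|(G r - G rho) - Q tau s * (r - rho)| <= e * `|r - rho|.
    set u := t0f a tau r in rt re close *.
    have -> : G r = reflect_ext (f_pos a tau) u by rewrite /G ff_reflect.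
    have -> : G rho = reflect_ext (f_pos a tau) s by rewrite /G ff_reflect.
    rewrite -re -te.
    (* A time between [s] and [u] is closer to [s] than [u] is, hence within the radius [d] on which
       [Q tau] varies by at most [e]. *)
    have Qe t : Num.min s u < t < Num.max s u -> `|Q tau t - Q tau s| <= e.
      rewrite gt_min lt_max => tsu; rewrite distrC; apply: dP => /=.
      move: close tsu; rewrite !ltr_norml => /andP[c1 c2] /andP[/orP[] h1 /orP[] h2]; lra.
    have [su|us] := leP s u.
      rewrite [X in _ <= _ * X]ler0_norm ?opprB; last first.
        move: su; rewrite le_eqVlt => /predU1P[->|su]; first by rewrite subrr.
        by rewrite subr_le0 ltW// (reflect_rho_lt Ha).
      by apply: reflect_increment => // t tsu; apply: Qe; rewrite min_l// max_r.
    have lt := reflect_rho_lt Ha rt tt us.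
    rewrite [X in _ <= _ * X]gtr0_norm ?subr_gt0// -normrN.
    have -> : - (reflect_ext (f_pos a tau) u - reflect_ext (f_pos a tau) s -
        Q tau s * (reflect_ext (P tau) u - reflect_ext (P tau) s)) =
      reflect_ext (f_pos a tau) s - reflect_ext (f_pos a tau) u -
        Q tau s * (reflect_ext (P tau) s - reflect_ext (P tau) u) by ring.
    apply: reflect_increment => //; first exact: ltW.
    by move=> t tsu; apply: Qe; rewrite min_r ?max_l// ltW.
  have r0 : 0 < `|r - rho| by rewrite normr_gt0 subr_eq0.
  rewrite -(ler_pM2r r0) -normrM mulrBl divfK ?subr_eq0//.
  by rewrite distrC.
- by rewrite eqxx.
Unshelve. all: end_near. Qed.

Lemma is_derive_gtt tau rho : Ddom a (tau, rho) ->
  is_derive rho 1 (gtt a tau) (2 * (1 - adot a tau * ff a tau (t0f a tau rho)) *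
    (adot a tau * Q tau (t0f a tau rho))).
Proof.
move=> Dp; have dG := is_derive_ff_t0f Dp.
set G := fun r => ff a tau (t0f a tau r) in dG.
have -> : gtt a tau = - ((cst 1 - adot a tau *: G) ^+ 2) by [].
apply: is_derive_eq; rewrite /GRing.scale/= expr1 !fctE /=.
rewrite /GRing.scale/= /G; ring.
Qed.

Lemma f_pos_cvg {T : Type} (F : set_system T) {FF : Filter F} (f g : T -> R) tau s :
  0 <= s -> s < tau -> f @ F --> tau -> g @ F --> s -> (\forall z \near F, 0 <= g z) ->
  f_pos a (f z) (g z) @[z --> F] --> f_pos a tau s.
Proof.
move=> s0 st fF gF g0; have tau0 : 0 < tau by exact: le_lt_trans st.
have fg : f_norm a (f z) (g z) * S (f z) (g z) @[z --> F] --> f_norm a tau s * S tau s.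
  by apply: cvgM; [exact: (f_norm_cvg Ha HL)|exact: (root_gap_cvg Ha)].
rewrite f_pos_norm//; apply: cvg_trans fg; apply: near_eq_cvg.
have fg0 : f z - g z @[z --> F] --> tau - s by exact: cvgB.
have ts0 : 0 < tau - s by rewrite subr_gt0.
near=> z; rewrite f_pos_norm//; first by near: z.
by rewrite -subr_gt0; near: z; exact: cvgr_gt fg0 _ ts0.
Unshelve. all: end_near. Qed.

Lemma ff_cvg {T : Type} (F : set_system T) {FF : Filter F} (f g : T -> R) tau t :
  `|t| < tau -> f @ F --> tau -> g @ F --> t ->
  ff a (f z) (g z) @[z --> F] --> ff a tau t.
Proof.
move=> tt fF gF; have tau0 : 0 < tau by exact: le_lt_trans tt.
have ntt : `|- t| < tau by rewrite normrN.
rewrite ff_reflect.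
have -> : (fun z => ff a (f z) (g z)) = (fun z => reflect_ext (f_pos a (f z)) (g z)).
  by apply/funext => z; rewrite ff_reflect.
apply: cvgD; first apply: cvgB.
- apply: f_pos_cvg; rewrite ?pos_part_ge0 ?pos_part_lt//; first exact: pos_part_cvg.
  by near=> z; exact: pos_part_ge0.
- apply: f_pos_cvg; rewrite ?pos_part_ge0 ?pos_part_lt//.
    by apply: pos_part_cvg; exact: cvgN.
  by near=> z; exact: pos_part_ge0.
- by apply: (@f_pos_cvg _ _ _ f (cst 0)) => //; [exact: cvg_cst|near=> z; rewrite /=].
Unshelve. all: end_near. Qed.

Lemma gtt_derive_continuous :
  {within Ddom a, continuous (fun p : R * R => derive1 (gtt a p.1) p.2)}.
Proof.
apply/subspace_continuousP => p Dp.
have [tt te] := t0f_spec Ha Dp; have [p1 p2 p3] := (DdomE Ha p).1 Dp.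
have dE q : Ddom a q -> derive1 (gtt a q.1) q.2 =
    2 * (1 - adot a q.1 * ff a q.1 (t0f a q.1 q.2)) *
    (adot a q.1 * Q q.1 (t0f a q.1 q.2)).
  case: q => tau rho Dq; rewrite derive1E.
  exact: (@derive_val _ _ _ _ _ _ _ (is_derive_gtt Dq)).
rewrite /from_subspace dE//.
have c1 : q.1 @[q --> within (Ddom a) (nbhs p)] --> p.1.
  by apply: cvg_within_filter; exact: cvg_fst.
have ct := t0f_cvg Ha Dp.
have ca : adot a q.1 @[q --> within (Ddom a) (nbhs p)] --> adot a p.1.
  by apply: (cvg_comp _ (adot a) c1); exact: (continuous_adot Ha).
(* The limit is taken within the domain, where the closed formula may replace [derive1]. *)
apply: (@cvg_trans _ ((2 * (1 - adot a q.1 * ff a q.1 (t0f a q.1 q.2)) *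
    (adot a q.1 * Q q.1 (t0f a q.1 q.2))) @[q --> within (Ddom a) (nbhs p)])).
  apply: near_eq_cvg; near=> q; rewrite dE//.
  by near: q; exact: withinT.
apply: cvgM.
  apply: cvgM; first exact: cvg_cst.
  apply: cvgB; first exact: cvg_cst.
  by apply: cvgM => //; exact: ff_cvg.
by apply: cvgM => //; exact: df_drho_cvg.
Unshelve. all: end_near. Qed.

End Derivative.

Theorem theorem5p12 (R : realType) (a : R -> R) :
  strongly_regular_scale_factor a ->
  ((adot a t @[t --> 0^'+] --> 0 /\
     exists2 eps : R, 0 < eps & forall t, 0 < t < eps -> 0 <= addot a t)
   \/ (exists2 L : R, 0 < L & adot a t @[t --> 0^'+] --> L)) ->
  (forall p, Ddom a p -> derivable (gtt a p.1) p.2 1) /\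
  {within Ddom a, continuous (fun p : R * R => derive1 (gtt a p.1) p.2)}.
Proof.
move=> Ha HL.
(* Either case supplies the finite limit that serves as the value of [adot_ext] at [0]. *)
have {HL} [L HL] : exists L : R, adot a t @[t --> 0^'+] --> L.
  by case: HL => [[H _]|[L _ H]]; [exists 0|exists L].
split; last exact: gtt_derive_continuous Ha HL.
by move=> [tau rho] Dp; case: (is_derive_gtt Ha HL Dp).
Qed.
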